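(* Let $k\ge 1$ be an integer. Then (in ZFC) the following statements are equivalent for any abelian group $C$. (i) $C$ is cotorsion. (ii) $\operatorname{Ext}(F,C)=0$ for all $\aleph_k$-free abelian groups $F$.
   Context: All groups are abelian, and $\operatorname{Ext}$ means $\operatorname{Ext}^1_{\mathbb{Z}}$. For an uncountable cardinal $\kappa$, a group $G$ is called $\kappa$-free if every subgroup $H\subseteq G$ of cardinality $|H|<\kappa$ is free (as an abelian group). A group $C$ is called cotorsion if $\operatorname{Ext}(F,C)=0$ for all torsion-free groups $F$. *)

(* Defs.v *)
From HB Require Import structures.
From mathcomp Require Import all_boot all_algebra ring_quotient.
From mathcomp Require Import freeg.
From mathcomp Require Import boolp classical_sets functions cardinality.

Set Implicit Arguments.
Unset Strict Implicit.
Unset Printing Implicit Defensive.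

Import GRing.Theory.
Local Open Scope classical_set_scope.
Local Open Scope card_scope.
Local Open Scope ring_scope.

Definition card_lt (T U : Type) (A : set T) (B : set U) : Prop :=
  (A #<= B) /\ ~ (B #<= A).

(* Cardinals are represented by types of that cardinality; [is_aleph k X] says
   |X| = aleph_k, where aleph_(k+1) is the least cardinal above aleph_k. *)
Fixpoint is_aleph (k : nat) (X : Type) : Prop :=
  match k with
  | 0 => [set: X] #= [set: nat]
  | j.+1 => exists Y : Type,
      [/\ is_aleph j Y,
          card_lt [set: Y] [set: X]
        & forall Z : Type,
            card_lt [set: Y] [set: Z] -> [set: X] #<= [set: Z]]
  end.

Section Groups.
Variable G : zmodType.

Definition torsion_free : Prop :=
  forall (x : G) (n : nat), (0 < n)%N -> x *+ n = 0 -> x = 0.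

Definition is_subgroup (H : set G) : Prop :=
  H 0 /\ (forall x y : G, H x -> H y -> H (x - y)).

Definition free_subgroup (H : set G) : Prop :=
  exists (I : choiceType) (f : {additive {freeg I / int} -> G}),
    injective f /\ range f = H.

Definition kappa_free (kappa : Type) : Prop :=
  forall H : set G,
    is_subgroup H -> card_lt H [set: kappa] -> free_subgroup H.

Definition aleph_free (k : nat) : Prop :=
  exists2 kappa : Type, is_aleph k kappa & kappa_free kappa.

End Groups.

Section HomZ.
Variables U V : zmodType.

Definition hom_pred : {pred (U -> V)} := fun f => `[< zmod_morphism f >].

Fact hom_pred_closed : zmod_closed hom_pred.
Proof.
split=> [|f g /asboolP hf /asboolP hg]; apply/asboolP => x y /=.
  by rewrite subr0.
by rewrite !fctE hf hg !opprB addrACA [RHS]addrACA; congr (_ + _); rewrite addrC.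
Qed.

HB.instance Definition _ :=
  GRing.isZmodClosed.Build (U -> V) hom_pred hom_pred_closed.

Record HomZ := MkHomZ { hom_val :> U -> V; _ : hom_val \in hom_pred }.

HB.instance Definition _ := [isSub for hom_val].
HB.instance Definition _ := [Choice of HomZ by <:].
HB.instance Definition _ := [SubChoice_isSubZmodule of HomZ by <:].

End HomZ.

Section Ext.
Variables F C : zmodType.

(* The canonical free resolution 0 -> relations -> Z^(F) -> F -> 0, where
   [augmentation] sends the formal combination of elements of F to its value.
   Ext^1(F, C) is the cokernel of Hom(Z^(F), C) -> Hom(relations, C). *)
Definition augmentation : {freeg F / int} -> F :=
  fglift (id : F -> zmodule F).

Fact augmentation_is_zmod_morphism : zmod_morphism augmentation.
Proof. exact: (@lift_is_additive int F (zmodule F) id). Qed.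

HB.instance Definition _ :=
  GRing.isZmodMorphism.Build {freeg F / int} F augmentation
    augmentation_is_zmod_morphism.

Definition rel_pred : {pred {freeg F / int}} := fun D => augmentation D == 0.

Fact rel_pred_closed : zmod_closed rel_pred.
Proof.
split=> [|x y /eqP hx /eqP hy]; apply/eqP; first exact: raddf0.
by rewrite augmentation_is_zmod_morphism hx hy subr0.
Qed.

HB.instance Definition _ :=
  GRing.isZmodClosed.Build {freeg F / int} rel_pred rel_pred_closed.

Record relations :=
  MkRelation { rel_val :> {freeg F / int}; _ : rel_val \in rel_pred }.

HB.instance Definition _ := [isSub for rel_val].
HB.instance Definition _ := [Choice of relations by <:].
HB.instance Definition _ := [SubChoice_isSubZmodule of relations by <:].

Definition restriction_pred : {pred HomZ relations C} :=
  fun f => `[< exists g : HomZ {freeg F / int} C,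
                 forall r : relations, f r = g (rel_val r) >].

Fact restriction_pred_closed : zmod_closed restriction_pred.
Proof.
split=> [|f f' /asboolP[g hg] /asboolP[g' hg']]; apply/asboolP.
  by exists 0 => r.
by exists (g - g') => r; rewrite /= -[LHS]/(f r - f' r) hg hg'.
Qed.

HB.instance Definition _ :=
  GRing.isZmodClosed.Build (HomZ relations C) restriction_pred
    restriction_pred_closed.

Definition Ext : zmodType := Quotient.quot restriction_pred.

End Ext.

Definition cotorsion (C : zmodType) : Prop :=
  forall F : zmodType, torsion_free F -> forall e : Ext F C, e = 0.

(* Main.v *)
From HB Require Import structures.
Require Import Defs.
From mathcomp Require Import all_boot all_order all_algebra.
From mathcomp Require Import generic_quotient ring_quotient freeg.
From mathcomp Require Import boolp classical_sets functions cardinality.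
From mathcomp Require wochoice.

(** If C is not cotorsion, Zorn's lemma isolates a rank-one obstruction: positive
    integers a_n and elements c_n of C such that the system
    x_n - a_n x_{n+1} = c_n has no solution in C.

    A branching system has nodes eta, which are k-tuples of infinite branches,
    and keys eta|<i,n>, obtained by cutting the i-th branch at length n. Let F be
    the group of functions from keys to the integers generated by the point masses
    e_x and by y_{eta,n} = sum_{m >= n} a_n ... a_{m-1} sum_i e_{eta|<i,m>}, so
    that y_{eta,n} - a_n y_{eta,n+1} = sum_i e_{eta|<i,n>}. If Ext(F,C) = 0, then
    for every d there is a map g from keys to C such that for each eta the system
    x_n - a_n x_{n+1} - sum_i g(eta|<i,n>) = d(eta,n) has a solution.

    In place of the aleph_k-free Black Box a diagonal argument defeats every g.
    The branches of a new direction are the maps from finite branches to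
    functions (old nodes -> C), so every g is, in that direction, itself a branch
    x; subtracting from d at (eta,x) the value that x takes on its own initial
    segments reduces k+1 directions to k, and no direction is left with the
    unsolvable system of the c_n.

    F is aleph_k-free because a family of fewer than aleph_k nodes spanned by few
    branches can be well-ordered so that each eta has a direction l with
    eta|<l,n> not a key of any earlier node, for n large: the transfinite
    induction on alephs spends one direction for each aleph. Along this order a
    leading-coefficient argument makes every small subgroup free. *)

Set Implicit Arguments.
Unset Strict Implicit.
Unset Printing Implicit Defensive.

Import Order.TTheory GRing.Theory Num.Theory.

Local Open Scope classical_set_scope.
Local Open Scope card_scope.
Local Open Scope ring_scope.

(** * Well-orders *)

Lemma wf_image (T U : Type) (R : T -> T -> Prop) (f : U -> T) :
  well_founded R -> well_founded (fun u v => R (f u) (f v)).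
Proof.
move=> Rwf; suff acc t u : f u = t -> Acc (fun u v => R (f u) (f v)) u.
  by move=> u; exact: acc erefl.
elim/(well_founded_ind Rwf): t u => t IH u fut; constructor=> v.
by rewrite fut => Rvt; exact: IH Rvt _ erefl.
Qed.

Definition is_wo (T : Type) (R : T -> T -> Prop) : Prop :=
  well_founded R /\ forall x y, [\/ R x y, x = y | R y x].

Section WellOrder.
Variables (T : Type) (R : T -> T -> Prop).
Hypothesis Rwo : is_wo R.

Lemma wo_irr x : ~ R x x.
Proof. by elim/(well_founded_ind Rwo.1): x => x IH Rxx; exact: (IH x Rxx). Qed.

Lemma wo_asym x y : R x y -> ~ R y x.
Proof.
elim/(well_founded_ind Rwo.1): x y => x IH y Rxy Ryx.
exact: (IH y Ryx x Ryx Rxy).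
Qed.

Lemma wo_cycle3 x y z : R x y -> R y z -> ~ R z x.
Proof.
elim/(well_founded_ind Rwo.1): x y z => x IH y z Rxy Ryz Rzx.
exact: (IH z Rzx x y).
Qed.

Lemma wo_trans x y z : R x y -> R y z -> R x z.
Proof.
move=> Rxy Ryz; case: (Rwo.2 x z) => // [xz|Rzx].
  by rewrite xz in Rxy; case: (wo_asym Rxy).
by case: (wo_cycle3 Rxy Ryz).
Qed.

Lemma wo_min (P : T -> Prop) :
  (exists x, P x) -> exists2 x, P x & forall y, R y x -> ~ P y.
Proof.
case=> x; elim/(well_founded_ind Rwo.1): x => x IH Px.
have [[y Ryx Py]|noy] := pselect (exists2 y, R y x & P y); first exact: IH Py.
by exists x => // y Ryx Py; apply: noy; exists y.
Qed.

Definition wo_le x y : Prop := R x y \/ x = y.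

Lemma wo_le_trans x y z : wo_le x y -> wo_le y z -> wo_le x z.
Proof.
move=> [Rxy|->] // [Ryz|<-]; last by left.
by left; exact: wo_trans Ryz.
Qed.

Lemma wo_le_lt_trans x y z : wo_le x y -> R y z -> R x z.
Proof. by move=> [Rxy|->] //; exact: wo_trans. Qed.

Lemma wo_le_total x y : wo_le x y \/ wo_le y x.
Proof. by case: (Rwo.2 x y) => [| |]; rewrite /wo_le; intuition. Qed.

Lemma wo_directed (I : eqType) (s : seq I) (P : I -> T -> Prop) (J : T -> Prop) :
  (exists x, J x) ->
  (forall i x y, wo_le x y -> P i x -> P i y) ->
  (forall i, i \in s -> exists2 x, J x & P i x) ->
  exists2 x, J x & forall i, i \in s -> P i x.
Proof.
move=> J0 Pmono; elim: s => [|a s IH] Ps.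
  by case: J0 => x Jx; exists x.
have [|x Jx Px] := IH; first by move=> i si; apply: Ps; rewrite inE si orbT.
have [|y Jy Py] := Ps a; first exact: mem_head.
have [xy|yx] := wo_le_total x y.
  exists y => // i; rewrite inE => /predU1P[->//|si].
  by apply: Pmono xy _; exact: Px.
exists x => // i; rewrite inE => /predU1P[->|/Px//].
exact: Pmono yx Py.
Qed.

Lemma wo_image (U : Type) (f : U -> T) :
  injective f -> is_wo (fun u v => R (f u) (f v)).
Proof.
move=> f_inj; split; first exact: (wf_image f Rwo.1).
by move=> u v; case: (Rwo.2 (f u) (f v)) => [?|/f_inj|?];
  [constructor 1|constructor 2|constructor 3].
Qed.

End WellOrder.

Lemma wo_exists (T : Type) : exists R : T -> T -> Prop, is_wo R.
Proof.
have [R Rwo] := wochoice.well_ordering_principle ({classic T} : eqType).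
have least (P : T -> Prop) : (exists x, P x) ->
    exists2 x, P x & forall y, P y -> R x y.
  case=> x0 Px0; have [|x [[Px minx] _]] := Rwo [pred x | `[< P x >]].
    by exists x0; apply/asboolP.
  exists x; first exact/asboolP.
  by move=> y Py; apply: minx; apply/asboolP.
have total x y : R x y \/ R y x.
  have [|z [->|->] zmin] := least (fun z => z = x \/ z = y).
  - by exists x; left.
  - by left; apply: zmin; right.
  - by right; apply: zmin; left.
have anti x y : R x y -> R y x -> x = y.
  move=> Rxy Ryx.
  have [|z [_ uniqz]] := Rwo [pred z | `[< z = x \/ z = y >]].
    by exists x; apply/asboolP; left.
  have [Rxx Ryy] : R x x /\ R y y by split; [case: (total x x)|case: (total y y)].
  rewrite -(uniqz x) ?(uniqz y) //; split; do ?by apply/asboolP; auto.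
    by move=> t /asboolP[->|->].
  by move=> t /asboolP[->|->].
exists (fun x y => R x y /\ x <> y); split.
  move=> x; apply: contrapT => nAcc.
  have [|z nAccz zmin] := least (fun z => ~ Acc (fun x y => R x y /\ x <> y) z).
    by exists x.
  apply: nAccz; constructor=> y [Ryz neq]; apply: contrapT => /zmin Rzy.
  by apply: neq; exact: anti.
move=> x y; have [->|neq] := pselect (x = y); first by constructor 2.
case: (total x y) => Rxy; first by constructor 1.
by constructor 3; split=> // yx; apply: neq.
Qed.

Lemma wo_lex (T U : Type) (R : T -> T -> Prop) (S : T -> U -> U -> Prop)
    (r : U -> T) :
  is_wo R -> (forall t, well_founded (S t)) ->
  (forall u v, r u = r v -> [\/ S (r v) u v, u = v | S (r v) v u]) ->
  is_wo (fun u v => R (r u) (r v) \/ r u = r v /\ S (r v) u v).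
Proof.
move=> Rwo Swf Stot; split; last first.
  move=> u v; case: (Rwo.2 (r u) (r v)) => [Ruv|ruv|Rvu].
  - by constructor 1; left.
  - case: (Stot u v ruv) => [Suv|->|Svu].
    + by constructor 1; right.
    + by constructor 2.
    + by constructor 3; right; rewrite ruv.
  - by constructor 3; left.
suff accr t u : r u = t ->
    Acc (fun u v => R (r u) (r v) \/ r u = r v /\ S (r v) u v) u.
  by move=> u; exact: accr erefl.
elim/(well_founded_ind Rwo.1): t u => t IHt u.
elim/(well_founded_ind (Swf t)): u => u IHu rut.
constructor=> v [|[]]; rewrite rut; first by move=> Rvt; exact: IHt Rvt _ erefl.
by move=> rvt Svu; exact: IHu.
Qed.

Lemma card_le_relP (T U : Type) (A : set T) (B : set U) :
  (A #<= B) <-> exists r : T -> U -> Prop,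
    (forall x, A x -> exists2 y, B y & r x y) /\
    (forall x x' y, A x -> A x' -> r x y -> r x' y -> x = x').
Proof.
split=> [/card_leP[f]|[r [rtot rinj]]].
  have f_inj : injective f by move=> u v; apply: inj; rewrite ?inE.
  exists (fun x y => exists2 Ax : x \in A, val (f (SigSub Ax)) = y & B y); split.
    move=> x /mem_set Ax; exists (val (f (SigSub Ax))); first exact: set_valP.
    by exists Ax => //; exact: set_valP.
  move=> x x' y _ _ [Ax fx _] [Ax' fx' _].
  have /val_inj/f_inj/(congr1 val) := etrans fx (esym fx').
  by [].
have tot (u : A) : exists v : B, r (val u) (val v).
  by have [y /mem_set By ruy] := rtot _ (set_valP u); exists (SigSub By).
pose f u := sval (cid (tot u)).
have fP u : r (val u) (val (f u)) by exact: svalP (cid (tot u)).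
have f_inj : {in [set: A] &, injective f}.
  move=> u v _ _ fuv; apply: val_inj; apply: (rinj _ _ (val (f u))).
  - exact: set_valP.
  - exact: set_valP.
  - exact: fP.
  - by rewrite fuv; exact: fP.
rewrite -(card_le_eql (card_setT A)) -(card_le_eqr (card_setT B)).
rewrite -(card_le_eql (inj_card_eq f_inj)).
exact: card_leT.
Qed.

Lemma card_le_inj (T U : Type) (A : set T) (B : set U) (f : T -> U) :
  (forall x, A x -> B (f x)) ->
  (forall x x', A x -> A x' -> f x = f x' -> x = x') -> A #<= B.
Proof.
move=> fAB finj; apply/card_le_relP; exists (fun x y => f x = y); split.
  by move=> x Ax; exists (f x) => //; exact: fAB.
by move=> x x' y Ax Ax' <- /esym; exact: finj.
Qed.

(* Transfinitely choose, for each [x], an element of [Z] not used below [x]. *)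
Lemma wo_compare (X Z : Type) (R : X -> X -> Prop) : is_wo R ->
  ([set: X] #<= [set: Z]) \/ exists x, [set: Z] #<= [set y | R y x].
Proof.
move=> Rwo.
have [[x Zx]|noseg] := pselect (exists x, [set: Z] #<= [set y | R y x]).
  by right; exists x.
left.
have fresh x (g : forall y, R y x -> Z) : exists z, forall y h, g y h <> z.
  apply: contrapT => nofresh; apply: noseg; exists x; apply/card_le_relP.
  exists (fun z y => exists h : R y x, g y h = z); split=> [z _|z z' y _ _].
    apply: contrapT => noy; apply: nofresh; exists z => y h gz.
    by apply: noy; exists y => //; exists h.
  by move=> [h <-] [h' <-]; rewrite (Prop_irrelevance h h').
pose f := Fix Rwo.1 (fun=> Z) (fun x g => sval (cid (fresh x g))).
have fE x : f x = sval (cid (fresh x (fun y _ => f y))).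
  rewrite /f Fix_eq //= => {}x g g' gg'; congr (sval (cid (fresh x _))).
  apply: functional_extensionality_dep => y.
  by apply: functional_extensionality_dep => h.
have f_neq x y : R y x -> f y <> f x.
  move=> Ryx; rewrite [f x]fE.
  by move: (svalP (cid (fresh x (fun y _ => f y)))) => /(_ y Ryx).
apply: (@card_le_inj _ _ _ _ f) => // x x' _ _ fxx'.
by case: (Rwo.2 x x') => [/f_neq|//|/f_neq]; rewrite fxx'.
Qed.

Lemma card_le_total (X Z : Type) :
  ([set: X] #<= [set: Z]) \/ ([set: Z] #<= [set: X]).
Proof.
have [R Rwo] := wo_exists X; have [->|[x Zx]] := wo_compare Z Rwo; first by left.
by right; apply: card_le_trans Zx _; exact: subset_card_le.
Qed.

(** * The cardinals aleph_k *)

Lemma aleph_exists (k : nat) : exists X : Type, is_aleph k X.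
Proof.
elim: k => [|k [Y alephY]]; first by exists nat; exact: card_eqxx.
suff [X YX Xmin] : exists2 X : Type, card_lt [set: Y] [set: X]
    & forall Z : Type, card_lt [set: Y] [set: Z] -> [set: X] #<= [set: Z].
  by exists X, Y; split.
have lt_of_nle (X : Type) : ~ ([set: X] #<= [set: Y]) -> card_lt [set: Y] [set: X].
  by move=> nXY; split=> //; case: (card_le_total X Y).
have [R Rwo] := wo_exists (set Y).
have nle_pow : ~ ([set: set Y] #<= [set: Y]).
  move=> /card_le_relP[r [rtot rinj]].
  have [f fP] : {f : set Y -> Y & forall A, r A (f A)}.
    by apply: (@choice _ _ r) => A; have [//|y _ ?] := rtot A; exists y.
  pose D : set Y := [set y | exists2 A, f A = y & ~ A y].
  have [DD|nDD] := pselect (D (f D)).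
    have [A fA nA] := DD; apply: nA; suff -> : A = D by [].
    by apply: (rinj _ _ (f D)) => //; rewrite -fA.
  by apply: (nDD); exists D.
pose big (X : Type) (S : X -> X -> Prop) :=
  is_wo S /\ forall x, [set y | S y x] #<= [set: Y].
suff [X [nXY [S [Swo segS]]]] :
    exists X : Type, ~ ([set: X] #<= [set: Y]) /\ exists S, @big X S.
  exists X; first exact: lt_of_nle.
  move=> Z [_ nZY]; have [//|[x Zx]] := wo_compare Z Swo.
  by case: nZY; exact: card_le_trans Zx (segS x).
have [bigx|small] := pselect (exists x, ~ ([set y | R y x] #<= [set: Y])).
  have [x nx minx] := wo_min Rwo bigx.
  exists [set y | R y x]; split; first by rewrite (card_le_eql (card_setT _)).
  exists (fun u v => R (val u) (val v)); split.
    by apply: wo_image => //; exact: val_inj.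
  move=> u; have /= Rux := set_valP u; have /contrapT := minx _ Rux.
  apply: card_le_trans; apply: (@card_le_inj _ _ _ _ val) => // v w _ _.
  exact: val_inj.
exists (set Y); split=> //; exists R; split=> // x; apply: contrapT => nx.
by apply: small; exists x.
Qed.

(* [thin j A] says that [A] has cardinality at most aleph_j. *)
Fixpoint thin (j : nat) (T : Type) (A : set T) : Prop :=
  match j with
  | 0 => countable A
  | i.+1 => exists (I : Type) (R : I -> I -> Prop) (B : I -> set T),
      [/\ is_wo R, forall x y, wo_le R x y -> B x `<=` B y,
          forall x, thin i (B x) & A `<=` \bigcup_x B x]
  end.

Lemma thin_bigcup (j : nat) (T U : Type) (A : set T) (f : T -> set U) :
  thin j A -> (forall x, A x -> countable (f x)) -> thin j (\bigcup_(x in A) f x).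
Proof.
move=> + cf; pose g x := if `[< A x >] then f x else set0.
have cg x : countable (g x) by rewrite /g; case: asboolP => // /cf.
have -> : \bigcup_(x in A) f x = \bigcup_(x in A) g x.
  by apply: eq_bigcupr => x Ax; rewrite /g asboolT.
move: g cg => {cf}g cg.
elim: j A => [|j IH] A /=; first by move=> cA; exact: bigcup_countable.
move=> [I [R [B [Rwo Bmono Bthin AB]]]].
exists I, R, (fun i => \bigcup_(x in B i) g x); split=> //.
- by move=> i i' ii' u [x Bx gx]; exists x => //; exact: Bmono Bx.
- by move=> i; exact: IH.
by move=> u [x /AB[i _ Bx] gx]; exists i => //; exists x.
Qed.

Lemma thin_sub (j : nat) (T : Type) (A B : set T) :
  A `<=` B -> thin j B -> thin j A.
Proof.
case: j => [|j] AB /=; first by apply: sub_countable; exact: subset_card_le.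
move=> [I [R [C [Rwo Cmono Cthin BC]]]]; exists I, R, C; split=> //.
exact: subset_trans BC.
Qed.

Lemma thin_card_le (j : nat) (T U : Type) (A : set T) (B : set U) :
  A #<= B -> thin j B -> thin j A.
Proof.
move=> /card_le_relP[r [rtot rinj]] thinB.
apply: (@thin_sub _ _ _ (\bigcup_(y in B) [set x | A x /\ r x y])).
  by move=> x Ax; have [y By rxy] := rtot x Ax; exists y.
apply: thin_bigcup => // y By; apply/countable_injP; exists (fun=> 0%N).
by move=> x x' /set_mem[Ax rx] /set_mem[Ax' rx'] _; exact: rinj rx rx'.
Qed.

Lemma thin_countable (j : nat) (T : Type) (A : set T) : countable A -> thin j A.
Proof.
move=> cA; elim: j => //= j IH.
exists unit, (fun _ _ => False), (fun=> A); split.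
- split; first by move=> x; constructor.
  by move=> [] []; exact: Or32.
- by move=> x y _ z.
- by [].
- by move=> x Ax; exists tt.
Qed.

Lemma thin_setU1 (j : nat) (T : Type) (A : set T) (a : T) :
  thin j A -> thin j (A `|` [set a]).
Proof.
elim: j A => [|j IH] A.
  move=> cA; have -> : A `|` [set a] =
      \bigcup_(b in [set: bool]) (if b then A else [set a]).
    apply/seteqP; split=> [x [Ax|ax]|x [[] _ /= ?]].
    - by exists true.
    - by exists false.
    - by left.
    - by right.
  by apply: bigcup_countable => // -[] _; [exact: cA|exact: countable1].
move=> [I [R [B [Rwo Bmono Bthin AB]]]].
have [[i0]|noI] := pselect (inhabited I); last first.
  apply/thin_countable/(sub_countable _ (countable1 a))/subset_card_le.
  by move=> x [/AB[i]|//]; case: noI.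
exists I, R, (fun i => B i `|` [set a]); split=> //.
- by move=> i i' ii' x [Bx|ax]; [left; exact: Bmono Bx|right].
- by move=> i; apply: IH; exact: Bthin.
- by move=> x [/AB[i _ Bx]|ax]; [exists i => //; left|exists i0 => //; right].
Qed.

Lemma aleph_thin (j : nat) (X : Type) : is_aleph j X -> thin j [set: X].
Proof.
elim: j X => [|j IH] X /=; first by rewrite card_eq_le => /andP[].
move=> [Y [/IH thinY ltYX Xmin]].
have [R Rwo] := wo_exists X.
have closed_seg (I : Type) (S : I -> I -> Prop) (i : I) :
    [set y | S y i] #<= [set: Y] -> thin j [set y | wo_le S y i].
  move=> /thin_card_le/(_ thinY)/(fun h => @thin_setU1 _ _ _ i h); apply: thin_sub.
  by move=> y [Sy|->]; [left|right].
have [bigx|small] := pselect (exists x, ~ ([set y | R y x] #<= [set: Y])).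
  have [x nx minx] := wo_min Rwo bigx.
  pose Seg : Type := [set y | R y x].
  pose S (u v : Seg) := R (val u) (val v).
  have /Xmin/card_le_relP[r [rtot rinj]] : card_lt [set: Y] [set: Seg].
    have nle : ~ ([set: Seg] #<= [set: Y]) by rewrite (card_le_eql (card_setT _)).
    by split=> //; case: (card_le_total Seg Y).
  exists Seg, S, (fun i => [set z | exists2 i', wo_le S i' i & r z i']).
  have Swo : is_wo S by apply: wo_image => //; exact: val_inj.
  split=> //.
  - by move=> i k ik z [i' ii' rz]; exists i' => //; exact: wo_le_trans ik.
  - move=> i; apply: (@thin_card_le _ _ _ _ [set i' | wo_le S i' i]); last first.
      apply: closed_seg; have /= Rix := set_valP i.
      have /contrapT := minx _ Rix.
      apply: card_le_trans; apply: (@card_le_inj _ _ _ _ val) => // v w _ _.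
      exact: val_inj.
    apply/card_le_relP; exists r; split; first by move=> z [i' ii' rz]; exists i'.
    by move=> z z' i' _ _; exact: (rinj z z' i' I I).
  - by move=> z _; have [//|i _ rz] := rtot z; exists i => //; exists i => //; right.
exists X, R, (fun x => [set y | wo_le R y x]); split=> //.
- by move=> x y xy z zx; exact: wo_le_trans xy.
- move=> x; apply: closed_seg; apply: contrapT => nx; apply: small; by exists x.
- by move=> x _; exists x => //; right.
Qed.

Lemma card_lt_aleph_thin (j : nat) (X U : Type) (A : set U) :
  is_aleph j.+1 X -> card_lt A [set: X] -> thin j A.
Proof.
move=> [Y [/aleph_thin thinY _ Xmin]] [_ nXA].
apply: thin_card_le thinY; case: (card_le_total A Y).
  by rewrite (card_le_eql (card_setT A)).
move=> YA; apply: contrapT => nAY; apply: nXA.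
rewrite -(card_le_eqr (card_setT A)); apply: Xmin; split=> //.
by rewrite (card_le_eql (card_setT A)).
Qed.

Lemma countable_lt_aleph (j : nat) (X U : Type) (A : set U) :
  is_aleph j.+1 X -> countable A -> card_lt A [set: X].
Proof.
have nat_le i Y : is_aleph i Y -> [set: nat] #<= [set: Y].
  elim: i Y => [|i IH] Y; first by rewrite /= card_eq_le => /andP[].
  by move=> [Z [/IH natZ [ZY _] _]]; exact: card_le_trans ZY.
move=> [Y [/nat_le natY [YX nXY] _]] cA; split.
  exact: card_le_trans cA (card_le_trans natY YX).
move=> XA; apply: nXY; exact: card_le_trans XA (card_le_trans cA natY).
Qed.

Lemma wo_ltn : is_wo (fun m n : nat => (m < n)%N).
Proof.
split=> [n|m n]; last by case: (ltngtP m n); [constructor 1|constructor 3|constructor 2].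
suff acc m : forall i, (i < m)%N -> Acc (fun m n : nat => (m < n)%N) i.
  exact: (acc n.+1).
elim: m => [i|m IH i im]; first by rewrite ltn0.
by constructor=> k ki; apply: IH; exact: leq_trans ki _.
Qed.

Lemma wo_option (T : Type) (R : T -> T -> Prop) : is_wo R ->
  exists S : option T -> option T -> Prop,
    is_wo S /\ forall x y, S (Some x) (Some y) -> R x y.
Proof.
move=> Rwo; pose S (ox oy : option T) : Prop :=
  if oy is Some y then if ox is Some x then R x y else True else False.
exists S; split; last by [].
split=> [ox|[x|] [y|]].
- have acc0 : Acc S None by constructor; case=> [y|] [].
  case: ox => [x|]; last exact: acc0.
  elim/(well_founded_ind Rwo.1): x => x IHx.
  by constructor; case=> [y Ryx|_]; [exact: IHx | exact: acc0].
- by case: (Rwo.2 x y) => [?|->|?]; [constructor 1|constructor 2|constructor 3].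
- by constructor 3.
- by constructor 1.
- by constructor 2.
Qed.

(** * Branching systems *)

(* [Node] plays the role of a product of branch spaces, [coord i eta] is the
   [i]-th branch of [eta], and [key i n eta] is [eta] with its [i]-th branch cut
   down to length [n]. *)
Record branching := Branching {
  Idx : finType;
  Node : Type;
  Key : Type;
  Crd : Type;
  coord : Idx -> Node -> Crd;
  key : Idx -> nat -> Node -> Key;
  lev : Key -> nat;
  key_lev : forall i n eta, lev (key i n eta) = n;
  key_coord : forall i j n eta nu, key i n eta = key j n nu ->
    i = j /\ forall c, c != i -> coord c eta = coord c nu;
  key_sep : forall eta nu, eta <> nu ->
    exists N, forall n i, (N <= n)%N -> key i n eta <> key i n nu;
  coord_inj : forall eta nu, (forall i, coord i eta = coord i nu) -> eta = nu
}.

Section Arrange.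
Variables (S : branching) (i0 : Idx S).

Definition box (A : set (Crd S)) : set (Node S) :=
  [set eta | forall i, A (coord i eta)].

Definition arranged (W : set (Node S)) (lt : Node S -> Node S -> Prop)
    (l : Node S -> Idx S) (N : Node S -> nat) : Prop :=
  is_wo lt /\ forall eta nu n, W eta -> W nu -> lt nu eta -> (N eta <= n)%N ->
    key (l eta) n eta <> key (l eta) n nu.

Lemma arrange0 (A : set (Crd S)) (u : Node S -> {set Idx S}) :
  countable A -> (forall eta, box A eta -> (0 < #|u eta|)%N) ->
  exists lt l N, @arranged (box A) lt l N /\ forall eta, box A eta -> l eta \in u eta.
Proof.
move=> /countable_injP[f finj] u_gt0.
pose e eta := pickle [seq f (coord i eta) | i <- enum (Idx S)].
have einj eta nu : box A eta -> box A nu -> e eta = e nu -> eta = nu.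
  move=> Aeta Anu /(pcan_inj (@pickleK _))/eq_in_map efE; apply: coord_inj => i.
  by apply: finj; rewrite ?inE //; apply: efE; rewrite mem_enum.
have [R Rwo] := wo_exists (Node S).
pose lt (eta nu : Node S) := (e eta < e nu)%N \/ e eta = e nu /\ R eta nu.
have ltwo : is_wo lt by exact: (@wo_lex _ _ (fun m n => (m < n)%N) (fun=> R) e wo_ltn
    (fun=> Rwo.1) (fun u v _ => Rwo.2 u v)).
have sep eta m : box A eta -> exists N, forall nu n i, box A nu -> nu <> eta ->
    (e nu < m)%N -> (N <= n)%N -> key i n eta <> key i n nu.
  move=> Aeta; elim: m => [|m [N NP]]; first by exists 0%N.
  have [[nu [Anu enu neq]]|nonu] :=
      pselect (exists nu, [/\ box A nu, e nu = m & nu <> eta]); last first.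
    exists N => nu n i Anu neq; rewrite ltnS leq_eqVlt => /predU1P[em|]; last exact: NP.
    by case: nonu; exists nu.
  have [M MP] := key_sep (fun h => neq (esym h)).
  exists (maxn N M) => nu' n i Anu' neq' + ; rewrite geq_max => + /andP[Nn Mn].
  rewrite ltnS leq_eqVlt => /predU1P[em|lm]; last exact: NP Nn.
  by rewrite (einj nu' nu) ?em //; exact: MP.
have [N NP] : {N : Node S -> nat & forall eta, box A eta ->
    forall nu n i, box A nu -> nu <> eta ->
    (e nu < e eta)%N -> (N eta <= n)%N -> key i n eta <> key i n nu}.
  apply: (@choice _ _ (fun eta N => box A eta -> forall nu n i, box A nu ->
    nu <> eta -> (e nu < e eta)%N -> (N <= n)%N -> key i n eta <> key i n nu)) => eta.
  have [Aeta|nAeta] := pselect (box A eta); last by exists 0%N.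
  by have [N NP] := sep eta (e eta) Aeta; exists N.
exists lt, (fun eta => odflt i0 [pick i in u eta]), N; split; last first.
  move=> eta /u_gt0; case: pickP => //= nou; rewrite (eq_card (_ : _ =i pred0)) ?card0 //.
split=> // eta nu n Aeta Anu lt_nu Nn; apply: NP => //.
  by move=> eq_nu; move: lt_nu; rewrite eq_nu; exact: (wo_irr ltwo).
case: lt_nu => // -[/(einj _ _ Anu Aeta) -> Reta].
by case: (wo_irr Rwo Reta).
Qed.

Lemma arrange (j : nat) (A : set (Crd S)) (u : Node S -> {set Idx S}) :
  thin j A -> (forall eta, box A eta -> (j < #|u eta|)%N) ->
  exists lt l N, @arranged (box A) lt l N /\ forall eta, box A eta -> l eta \in u eta.
Proof.
elim: j A u => [|j IH] A u; first exact: arrange0.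
move=> [I [R [B [Rwo Bmono Bthin AB]]]] u_gt.
have in_box J eta : (exists x, J x) -> (forall i, exists2 x, J x & B x (coord i eta)) ->
    exists2 x, J x & box (B x) eta.
  move=> J0 BJ.
  have Bcoord i x y : wo_le R x y -> B x (coord i eta) -> B y (coord i eta).
    by move=> xy; exact: Bmono xy _.
  have [x Jx Bx] := wo_directed (s := enum (Idx S)) Rwo J0 Bcoord (fun i _ => BJ i).
  by exists x => // i; apply: Bx; rewrite mem_enum.
have [r rP] : {r : Node S -> option I & forall eta, box A eta -> exists x,
    [/\ r eta = Some x, box (B x) eta & forall y, R y x -> ~ box (B y) eta]}.
  apply: (@choice _ _ (fun eta ox => box A eta -> exists x,
    [/\ ox = Some x, box (B x) eta & forall y, R y x -> ~ box (B y) eta])) => eta.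
  have [Aeta|nA] := pselect (box A eta); last by exists None.
  have [||x _ Bx] := in_box setT eta.
  - by have [x _ _] := AB _ (Aeta i0); exists x.
  - by move=> i; have [x _ Bx] := AB _ (Aeta i); exists x.
  have [y By ymin] := wo_min Rwo (ex_intro (fun x => box (B x) eta) x Bx).
  by exists (Some y) => _; exists y.
(* A branch of [eta] that is new at the stage where [eta] appears. *)
have [c cP] : {c : Node S -> Idx S & forall eta x, box A eta -> r eta = Some x ->
    forall y, R y x -> ~ B y (coord (c eta) eta)}.
  apply: (@choice _ _ (fun eta i => forall x, box A eta -> r eta = Some x ->
    forall y, R y x -> ~ B y (coord i eta))) => eta.
  have [Aeta|nA] := pselect (box A eta); last by exists i0.
  have [x [rx Bx xmin]] := rP eta Aeta.
  apply: contrapT => noc.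
  have new i : exists2 y, R y x & B y (coord i eta).
    apply: contrapT => noy; apply: noc; exists i => x' _; rewrite rx => -[<-] y Ryx By.
    by apply: noy; exists y.
  have [||y Ryx By] := in_box (fun y => R y x) eta => //.
    by have [y Ryx _] := new i0; exists y.
  exact: xmin Ryx By.
pose u' eta := u eta :\ c eta.
have [R0 R0wo] := wo_exists (Node S).
have stage (ox : option I) : exists p :
    (Node S -> Node S -> Prop) * (Node S -> Idx S) * (Node S -> nat),
    is_wo p.1.1 /\ forall x, ox = Some x ->
      arranged (box (A `&` B x)) p.1.1 p.1.2 p.2 /\
      forall eta, box (A `&` B x) eta -> p.1.2 eta \in u' eta.
  case: ox => [x|]; last by exists (R0, fun=> i0, fun=> 0%N).
  have [||lt [l [N [arr lu]]]] := IH (A `&` B x) u'.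
  - by apply: thin_sub (Bthin x) => ? [].
  - move=> eta Aeta; have := u_gt eta (fun i => (Aeta i).1).
    by rewrite (cardsD1 (c eta)) -ltnS; case: (_ \in _) => //; exact: ltnW.
  exists (lt, l, N); split; first exact: arr.1.
  by move=> _ [<-]; split.
pose p ox := sval (cid (stage ox)).
have pP ox := svalP (cid (stage ox)).
have [Ro [Rowo RoP]] := wo_option Rwo.
exists (fun nu eta => Ro (r nu) (r eta) \/ r nu = r eta /\ (p (r eta)).1.1 nu eta).
exists (fun eta => (p (r eta)).1.2 eta), (fun eta => (p (r eta)).2 eta).
have box_stage eta x : box A eta -> box (B x) eta -> box (A `&` B x) eta by move=> ? ? i.
split; last first.
  move=> eta Aeta; have [x [rx Bx _]] := rP eta Aeta.
  have [_ /(_ x rx)[_ /(_ eta (box_stage _ _ Aeta Bx))]] := pP (r eta).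
  by rewrite in_setD1 => /andP[].
split.
  exact: (@wo_lex _ _ Ro (fun ox => (p ox).1.1) r Rowo (fun ox => (pP ox).1.1)
    (fun u v _ => (pP _).1.2 u v)).
move=> eta nu n Aeta Anu.
have [x [rx Bx _]] := rP eta Aeta; have [y [ry By _]] := rP nu Anu.
have [_ /(_ x rx)[[_ arr] /(_ eta (box_stage _ _ Aeta Bx))]] := pP (r eta).
rewrite in_setD1 => /andP[neq_c _].
case=> [Rnu _|[rr ltnu]]; last first.
  apply: arr; [exact: box_stage Aeta Bx| |exact: ltnu].
  by apply: box_stage => //; move: rr; rewrite rx ry => -[<-].
move=> /key_coord[_ /(_ (c eta))]; rewrite eq_sym => /(_ neq_c) eqc.
apply: (cP eta x Aeta rx y); last by rewrite eqc; exact: By.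
by apply: RoP; rewrite -rx -ry.
Qed.

End Arrange.

(** * The diagonal system *)

Lemma sum_option (V : nmodType) (T : finType) (F : option T -> V) :
  \sum_i F i = F None + \sum_i F (Some i).
Proof.
rewrite (bigD1 None) //=; congr (_ + _).
rewrite (reindex_omap (@Some T) id) /=; last by case.
by apply: eq_bigl => i; rewrite eqxx.
Qed.

(* A branch [x : diag_branch D] is the same thing as a function from the nodes of
   the tree [{n & trunk D n}] of its own initial segments to [D]. *)
Section DiagTree.
Variable D : Type.

Fixpoint trunk (n : nat) : Type :=
  if n is m.+1 then (trunk m * (trunk m -> D))%type else unit.

Definition diag_branch : Type := forall n, trunk n -> D.

Fixpoint cut (x : diag_branch) (n : nat) : trunk n :=
  match n with
  | 0 => tt
  | m.+1 => (cut x m, x m)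
  end.

Lemma cut_eq (x y : diag_branch) n m : (m < n)%N -> cut x n = cut y n -> x m = y m.
Proof.
elim: n => // n IH; rewrite ltnS leq_eqVlt => /predU1P[->|mn] [cxy xy] //.
exact: IH.
Qed.

End DiagTree.

Section ExtendBranching.
Variables (S : branching) (D : Type).

Definition ext_coord (i : option (Idx S)) (eta : Node S * diag_branch D) :
    Crd S + diag_branch D :=
  if i is Some j then inl (coord j eta.1) else inr eta.2.

Definition ext_key (i : option (Idx S)) (n : nat) (eta : Node S * diag_branch D) :
    Key S * diag_branch D + Node S * {n & trunk D n} :=
  if i is Some j then inl (key j n eta.1, eta.2)
  else inr (eta.1, Tagged (trunk D) (cut eta.2 n)).

Definition ext_lev (x : Key S * diag_branch D + Node S * {n & trunk D n}) : nat :=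
  match x with inl p => lev p.1 | inr p => tag p.2 end.

Fact ext_key_lev i n eta : ext_lev (ext_key i n eta) = n.
Proof. by case: i => //= i; exact: key_lev. Qed.

Fact ext_key_coord i j n eta nu : ext_key i n eta = ext_key j n nu ->
  i = j /\ forall c, c != i -> ext_coord c eta = ext_coord c nu.
Proof.
case: i j eta nu => [i|] [j|] [l x] [m y] //= [].
  by move=> /key_coord[-> eqc] ->; split=> // -[c|] //= /eqc ->.
by move=> -> _; split=> // -[].
Qed.

Fact ext_key_sep eta nu : eta <> nu ->
  exists N, forall n i, (N <= n)%N -> ext_key i n eta <> ext_key i n nu.
Proof.
case: eta nu => [l x] [m y] neq.
have [lm|lm] := pselect (l = m); last first.
  have [N NP] := key_sep lm.
  by exists N => n [i|] Nn //= []; [move=> e _; exact: NP e|].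
have [p xyp] : exists p, x p <> y p.
  apply: contrapT => nop; apply: neq; rewrite lm; congr (_, _).
  by apply: functional_extensionality_dep => p; apply: contrapT => xy; apply: nop; exists p.
exists p.+1 => n [i|] pn /=; first by move=> [_ xy]; apply: xyp; rewrite xy.
move=> [_ tagE]; apply: xyp; apply: cut_eq pn _.
exact: (@eq_from_Tagged _ (trunk D) n _ _ tagE).
Qed.

Fact ext_coord_inj eta nu :
  (forall i, ext_coord i eta = ext_coord i nu) -> eta = nu.
Proof.
case: eta nu => [l x] [m y] eqc; have [->] := eqc None.
by congr (_, _); apply: coord_inj => i; have [] := eqc (Some i).
Qed.

Definition ext_branching : branching :=
  Branching ext_key_lev ext_key_coord ext_key_sep ext_coord_inj.

End ExtendBranching.

Definition unit_branching : branching.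
Proof.
by refine (@Branching void unit unit unit (fun _ => id) (fun _ _ => id) (fun=> 0%N) _ _ _ _);
   do ?[by case | by move=> [] []].
Defined.

Definition solves (S : branching) (C : zmodType) (a : nat -> nat)
    (d : Node S -> nat -> C) (g : Key S -> C) (eta : Node S) (x : nat -> C) : Prop :=
  forall n, x n - x n.+1 *+ a n - \sum_i g (key i n eta) = d eta n.

Lemma diagonal_system (C : zmodType) (a : nat -> nat) (c : nat -> C) (k : nat) :
  (forall x : nat -> C, ~ forall n, x n - x n.+1 *+ a n = c n) ->
  exists S : branching, #|Idx S| = k /\ exists d : Node S -> nat -> C,
    forall g, exists eta, forall x, ~ solves a d g eta x.
Proof.
move=> unsolvable; elim: k => [|k [S [cardS [d dP]]]].
  exists unit_branching; split; first exact: card_void.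
  exists (fun=> c) => g; exists tt => x sol; apply: (unsolvable x) => n.
  by rewrite -[RHS](sol n) big_pred0 ?subr0 // => -[].
pose D := Node S -> C.
exists (ext_branching S D); split; first by rewrite card_option cardS.
exists (fun eta n => d eta.1 n - eta.2 n (cut eta.2 n) eta.1) => g.
pose x : diag_branch D := fun n t eta => g (inr (eta, Tagged (trunk D) t)).
have [eta etaP] := dP (fun p => g (inl (p, x))).
exists (eta, x) => z sol; apply: (etaP z) => n.
by have := sol n; rewrite sum_option /= opprD addrCA addrC => /addIr.
Qed.

(** * Free abelian groups, subgroups and extensions *)

Lemma subrBB (V : zmodType) (u v w z : V) : (u - v) - (w - z) = (u - w) - (v - z).
Proof. by rewrite !opprB addrACA [RHS]addrACA [- v + _]addrC. Qed.

Section Lift.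
Variables (K : choiceType) (M : zmodType).

Definition lift (f : K -> M) : {freeg K / int} -> M :=
  fglift (f : K -> zmodule M).

Lemma liftB (f : K -> M) : zmod_morphism (lift f).
Proof. exact: (@lift_is_additive int K (zmodule M) f). Qed.

HB.instance Definition _ (f : K -> M) :=
  GRing.isZmodMorphism.Build {freeg K / int} M (lift f) (liftB f).

Lemma lift1 (f : K -> M) x : lift f << x >> = f x.
Proof. by rewrite /lift liftU scale1r. Qed.

Lemma freeg_additive_sum (g : {additive {freeg K / int} -> M}) D :
  g D = \sum_(x <- dom D) g << x >> *~ coeff x D.
Proof.
rewrite -{1}[D]freeg_sumE raddf_sum; apply: eq_bigr => x _.
by rewrite -raddfMz /= freegU_mulz intz.
Qed.

End Lift.

Section Subgroup.
Variable V : zmodType.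
Implicit Types H S : set V.

Lemma subgroup0 H : is_subgroup H -> H 0. Proof. by case. Qed.

Lemma subgroupB H x y : is_subgroup H -> H x -> H y -> H (x - y).
Proof. by case=> _; apply. Qed.

Lemma subgroupN H x : is_subgroup H -> H x -> H (- x).
Proof. by move=> sH Hx; rewrite -sub0r; apply: subgroupB => //; exact: subgroup0. Qed.

Lemma subgroupD H x y : is_subgroup H -> H x -> H y -> H (x + y).
Proof. by move=> sH Hx Hy; rewrite -[y]opprK; apply: subgroupB => //; exact: subgroupN. Qed.

Lemma subgroupMz H x n : is_subgroup H -> H x -> H (x *~ n).
Proof.
move=> sH Hx; have Hn m : H (x *+ m).
  by elim: m => [|m IH]; [exact: subgroup0|rewrite mulrS; exact: subgroupD].
by case: n => m; [exact: Hn|rewrite NegzE mulrNz; apply: subgroupN => //; exact: Hn].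
Qed.

Lemma subgroup_sum H (I : eqType) (s : seq I) (P : pred I) (f : I -> V) :
  is_subgroup H -> (forall i, i \in s -> P i -> H (f i)) ->
  H (\sum_(i <- s | P i) f i).
Proof.
move=> sH Hf; rewrite big_seq_cond.
by elim/big_rec: _ => [|i x /andP[/Hf/[apply] Hi Hx]]; [exact: subgroup0|exact: subgroupD].
Qed.

Definition span S : set V :=
  [set x | forall H, is_subgroup H -> S `<=` H -> H x].

Lemma span_subgroup S : is_subgroup (span S).
Proof.
split=> [H sH _|x y Sx Sy H sH SH]; first exact: subgroup0.
by apply: subgroupB => //; [exact: Sx|exact: Sy].
Qed.

Lemma sub_span S : S `<=` span S.
Proof. by move=> x Sx H _; exact. Qed.

Lemma span_sub S S' : S `<=` S' -> span S `<=` span S'.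
Proof.
move=> SS' x Sx; apply: Sx; first exact: span_subgroup.
exact: subset_trans (@sub_span S').
Qed.

Section SpanType.
Variable S : set V.

Definition span_pred : {pred V} := fun x => `[< span S x >].

Fact span_pred_closed : zmod_closed span_pred.
Proof.
split=> [|x y /asboolP Sx /asboolP Sy]; apply/asboolP.
  exact: subgroup0 (span_subgroup S).
exact: subgroupB (span_subgroup S) Sx Sy.
Qed.

HB.instance Definition _ := GRing.isZmodClosed.Build V span_pred span_pred_closed.

Record span_type := MkSpan { span_val :> V; _ : span_val \in span_pred }.

HB.instance Definition _ := [isSub for span_val].
HB.instance Definition _ := [Choice of span_type by <:].
HB.instance Definition _ := [SubChoice_isSubZmodule of span_type by <:].

Definition to_span x (Sx : span S x) : span_type := MkSpan (asboolT Sx).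

Lemma span_valP (x : span_type) : span S (span_val x).
Proof. by case: x => x Sx /=; exact/asboolP. Qed.

End SpanType.
End Subgroup.

Section Ext0.
Variables F C : zmodType.

Lemma ext_pi_eq0 (f : HomZ (relations F) C) :
  (\pi_(Ext F C)%qT f = 0) <->
  exists g : {additive {freeg F / int} -> C}, forall r, f r = g (rel_val r).
Proof.
have <- : \pi_(Ext F C)%qT 0 = 0 by rewrite !piE.
split.
  move/eqP; rewrite -Quotient.idealrBE subr0 => /asboolP[[g gP] fg].
  move: (gP) => /asboolP gB.
  pose ga := GRing.isZmodMorphism.Build {freeg F / int} C g gB.
  pose g' : {additive {freeg F / int} -> C} := HB.pack g ga.
  by exists g'.
move=> [g fg]; apply/eqP; rewrite -Quotient.idealrBE subr0; apply/asboolP.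
have gP : (g : _ -> _) \in @hom_pred {freeg F / int} C by apply/asboolP; exact: raddfB.
by exists (MkHomZ gP).
Qed.

Lemma ext0P : (forall e : Ext F C, e = 0) <->
  forall f : relations F -> C, zmod_morphism f ->
  exists g : {additive {freeg F / int} -> C}, forall r, f r = g (rel_val r).
Proof.
split=> [ext0 f fB|ext e].
  have fP : f \in @hom_pred (relations F) C by exact/asboolP.
  by have /ext_pi_eq0 := ext0 (\pi_(Ext F C)%qT (MkHomZ fP)).
elim/quotW: e => f; apply/ext_pi_eq0; apply: ext.
by case: f => f fP; exact/asboolP.
Qed.

End Ext0.

Lemma augmentationE (F : zmodType) : @augmentation F = lift id.
Proof. by []. Qed.

Lemma ext0_extend_ker (F C E : zmodType) (p : {additive E -> F}) (r : E -> C) :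
  (forall e : Ext F C, e = 0) ->
  (forall y, exists x, p x = y) ->
  (forall x y, p x = 0 -> p y = 0 -> r (x - y) = r x - r y) ->
  exists h : {additive E -> C}, forall x, p x = 0 -> h x = r x.
Proof.
move=> /ext0P ext0 psurj rB.
have [s sK] := choice psurj.
have pL D : p (lift s D) = augmentation D.
  have -> : p (lift s D) = (p \o lift s) D by [].
  rewrite augmentationE freeg_additive_sum.
  rewrite [RHS]freeg_additive_sum; apply: eq_bigr => x _.
  by rewrite /= !lift1 sK.
have kerL (D : relations F) : p (lift s (rel_val D)) = 0.
  by rewrite pL; case: D => D /= /eqP.
have [|g gP] := ext0 (fun D => r (lift s (rel_val D))).
  by move=> D D' /=; rewrite raddfB rB ?kerL.
have gE D : augmentation D = 0 -> g D = r (lift s D).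
  by move=> /eqP D0; rewrite -(gP (MkRelation D0)).
pose h x := g << p x >> + r (x - s (p x)).
have ker_s x : p (x - s (p x)) = 0 by rewrite raddfB sK subrr.
have hB : zmod_morphism h.
  move=> x y; rewrite /h.
  pose D : {freeg F / int} := << p (x - y) >> - (<< p x >> - << p y >>).
  have D0 : augmentation D = 0.
    by rewrite /D augmentationE !liftB !lift1 raddfB subrr.
  have LD : lift s D = s (p (x - y)) - (s (p x) - s (p y)).
    by rewrite /D !liftB !lift1.
  have -> : x - y - s (p (x - y)) = (x - s (p x)) - (y - s (p y)) - lift s D.
    rewrite LD [X in _ = _ + X]opprB addrA; congr (_ - _).
    by rewrite addrACA -opprD !subrK.
  have gD : g D = g << p (x - y) >> - (g << p x >> - g << p y >>).
    by rewrite /D raddfB [g (_ - _)]raddfB.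
  have pE : p (x - s (p x) - (y - s (p y))) = 0 by rewrite raddfB !ker_s subrr.
  rewrite (rB _ _ pE (etrans (pL D) D0)) (rB _ _ (ker_s x) (ker_s y)) -(gE D D0) gD.
  rewrite [X in _ + (_ + X)]opprB addrCA [X in _ + X]addrC subrK.
  by rewrite opprD [RHS]addrACA addrC.
pose ha := GRing.isZmodMorphism.Build E C h hB.
pose h' : {additive E -> C} := HB.pack h ha.
exists h' => x px; rewrite /= /h px.
have -> : g << 0 >> = r (s 0).
  by rewrite gE ?lift1 // augmentationE lift1.
by rewrite rB ?sK // addrC subrK.
Qed.

(** * A criterion for freeness *)

Lemma subgroup_additiveMz (V U : zmodType) (W : set V) (f : V -> U) x n :
  is_subgroup W -> (forall x y, W x -> W y -> f (x - y) = f x - f y) ->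
  W x -> f (x *~ n) = f x *~ n.
Proof.
move=> sW fB Wx; have W0 := subgroup0 sW.
have f0 : f 0 = 0 by rewrite -(subrr 0) fB // subrr.
have fN y : W y -> f (- y) = - f y by move=> Wy; rewrite -sub0r fB // f0 sub0r.
have fMn m : f (x *+ m) = f x *+ m.
  elim: m => [|m IH]; first by rewrite !mulr0n.
  rewrite mulrSr -[x in _ + x]opprK fB ?fN ?opprK ?IH ?mulrSr //.
    exact: (subgroupMz m sW Wx).
  exact: subgroupN.
case: n => m; first exact: fMn.
by rewrite NegzE !mulrNz fN ?fMn //; exact: (subgroupMz m.+1 sW Wx).
Qed.

Lemma int_subgroup_generator (P : set int) :
  is_subgroup P -> (exists2 n, P n & n != 0) ->
  exists d : nat, [/\ P d%:Z, (0 < d)%N & forall n, P n -> exists q, n = q * d%:Z].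
Proof.
move=> sP [n0 Pn0 n0_neq0].
have [d0 d0P d0min] : exists2 d : nat, P d%:Z /\ (0 < d)%N &
    forall e : nat, P e%:Z -> (0 < e)%N -> (d <= e)%N.
  have exd : exists d : nat, `[< P d%:Z >] && (0 < d)%N.
    exists `|n0|%N; rewrite absz_gt0 n0_neq0 andbT; apply/asboolP.
    by rewrite abszE; case: (ger0P n0) => _ //; exact: subgroupN.
  have [d /andP[/asboolP Pd d_gt0] dmin] := ex_minnP exd.
  by exists d => // e Pe e_gt0; apply: dmin; rewrite e_gt0 andbT; exact/asboolP.
exists d0; case: d0P => Pd d_gt0; split=> //.
move=> n Pn; exists (n %/ d0)%Z.
have d_neq0 : d0%:Z != 0 by rewrite eqz_nat -lt0n.
have Pmod : P (n %% d0)%Z.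
  by rewrite /modz; apply: subgroupB => //; rewrite mulrC -mulrzz; exact: subgroupMz.
have := modz_ge0 n d_neq0; have := ltz_pmod n (d := d0%:Z); rewrite ltz_nat d_gt0.
rewrite {3}(divz_eq n d0).
case: (n %% d0)%Z Pmod => // m Pm /(_ isT); rewrite ltz_nat => ltmd _.
case: m Pm ltmd => [|m] Pm ltmd; first by rewrite addr0.
by have := d0min _ Pm isT; rewrite leqNgt ltmd.
Qed.

Section FreeCriterion.
Variables (G : zmodType) (H : set G) (I : Type) (R : I -> I -> Prop).
Variables (W : I -> set G) (c : I -> G -> int).
Hypotheses (sH : is_subgroup H) (Rwo : is_wo R).
Hypothesis c_lead : forall x, H x -> x <> 0 -> exists2 i, W i x & c i x != 0.
Hypothesis c_additive : forall i x y, W i x -> W i y ->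
  W i (x - y) /\ c i (x - y) = c i x - c i y.
Hypothesis c_lower : forall i j x, R j i -> W j x -> W i x /\ c i x = 0.

Let lead i : Prop := exists x, [/\ H x, W i x & c i x != 0].

Let pivotP i : lead i -> exists h, [/\ H h, W i h, c i h != 0 &
  forall x, H x -> W i x -> exists q, c i x = q * c i h].
Proof.
move=> [x [Hx Wx cx]].
have [||d [[h [Hh Wh hd]] d_gt0 dP]] :=
    @int_subgroup_generator (fun n => exists h, [/\ H h, W i h & c i h = n]).
- split.
    have [Wxx cxx] := c_additive Wx Wx; exists (x - x).
    by split=> //; [exact: subgroupB|rewrite cxx subrr].
  move=> m n [h [Hh Wh <-]] [k [Hk Wk <-]]; exists (h - k).
  by have [Whk chk] := c_additive Wh Wk; split=> //; exact: subgroupB.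
- by exists (c i x) => //; exists x.
exists h; rewrite hd; split=> //; first by rewrite eqz_nat -lt0n.
by move=> y Hy Wy; apply: dP; exists y.
Qed.

Let B : choiceType := {classic {i : I | lead i}}.
Let idx (b : B) : I := sval (b : {i : I | lead i}).
Let pivot (b : B) : G := sval (cid (pivotP (svalP (b : {i : I | lead i})))).

Let pivot_spec (b : B) : [/\ H (pivot b), W (idx b) (pivot b),
  c (idx b) (pivot b) != 0 &
  forall x, H x -> W (idx b) x -> exists q, c (idx b) x = q * c (idx b) (pivot b)].
Proof. exact: svalP (cid (pivotP (svalP (b : {i : I | lead i})))). Qed.

Let idx_inj : injective idx.
Proof. by move=> [i pi] [j pj] /= ij; apply: eq_exist. Qed.

Let lift_pivot_inj D : lift pivot D = 0 -> D = 0.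
Proof.
move=> LD; apply: contrapT => D_neq0.
have [b bD bmax] : exists2 b, b \in dom D &
    forall b', b' \in dom D -> wo_le R (idx b') (idx b).
  have : dom D != [::] by rewrite dom_eq0; exact/eqP.
  elim: (dom D) => // b [|b' s] IH _.
    by exists b; rewrite ?mem_head // => b'; rewrite inE => /eqP ->; right.
  have [//|m ms mmax] := IH.
  have [bm|mb] := wo_le_total Rwo (idx b) (idx m).
    exists m; first by rewrite in_cons ms orbT.
    by move=> z; rewrite in_cons => /predU1P[->|/mmax].
  exists b; first exact: mem_head.
  move=> z; rewrite in_cons => /predU1P[->|/mmax zm]; first by right.
  exact: (wo_le_trans Rwo) zm mb.
have [Hb Wb cb _] := pivot_spec b.
pose N x := W (idx b) x /\ c (idx b) x = 0.
have [W0 c0] := c_additive Wb Wb; rewrite !subrr in W0 c0.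
have sN : is_subgroup N.
  split=> // x y [Wx cx] [Wy cy]; have [Wxy cxy] := c_additive Wx Wy.
  by split=> //; rewrite cxy cx cy subrr.
have sW : is_subgroup (W (idx b)).
  by split=> // x y Wx Wy; have [] := c_additive Wx Wy.
have cMz n x : W (idx b) x -> c (idx b) (x *~ n) = c (idx b) x *~ n.
  by apply: subgroup_additiveMz => // u v Wu Wv; have [] := c_additive Wu Wv.
move: LD; rewrite freeg_additive_sum (bigD1_seq b) ?uniq_dom //= lift1.
set y := \sum_(_ <- _ | _) _.
have [Wy cy] : N y.
  apply: subgroup_sum => // b' /bmax [ltb|/idx_inj eqb] neq; last by rewrite eqb eqxx in neq.
  rewrite lift1; apply: subgroupMz => //; apply: c_lower ltb _.
  by have [] := pivot_spec b'.
move=> /eqP; rewrite addr_eq0 => /eqP pivotE.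
have : c (idx b) (pivot b *~ coeff b D) = 0.
  by rewrite pivotE -sub0r; have [_ ->] := c_additive W0 Wy; rewrite c0 cy subrr.
rewrite cMz // mulrzz => /eqP; rewrite mulf_eq0 (negbTE cb) /=.
by apply/negP; rewrite -mem_dom.
Qed.

Let lift_pivotH D : H (lift pivot D).
Proof.
rewrite freeg_additive_sum; apply: subgroup_sum => // b _ _.
by rewrite /= lift1; apply: subgroupMz => //; have [] := pivot_spec b.
Qed.

Let lift_pivot_surj i x : H x -> W i x -> exists D, lift pivot D = x.
Proof.
elim/(well_founded_ind Rwo.1): i x => i IH.
have below x : H x -> W i x -> c i x = 0 -> exists D, lift pivot D = x.
  move=> Hx Wx cx; have [->|x_neq0] := pselect (x = 0); first by exists 0; rewrite raddf0.
  have [j Wj cj] := c_lead Hx x_neq0.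
  case: (Rwo.2 i j) => [Rij|ij|Rji].
  - by have [_ c0] := c_lower Rij Wx; rewrite c0 eqxx in cj.
  - by rewrite -ij cx eqxx in cj.
  - exact: IH Rji _ Hx Wj.
move=> x Hx Wx; have [cx|cx] := eqVneq (c i x) 0; first exact: below.
have [b bi] : exists b, idx b = i.
  have pi : lead i by exists x.
  by exists (exist _ i pi).
have [Hb] := pivot_spec b; rewrite bi => Wb cb /(_ x Hx Wx)[q qE].
have sW : is_subgroup (W i).
  split=> [|y z Wy Wz]; last by have [] := c_additive Wy Wz.
  by have [] := c_additive Wb Wb; rewrite subrr.
have Wq : W i (pivot b *~ q) by exact: subgroupMz.
have [Wxq cxq] := c_additive Wx Wq.
have [||D DE] := below (x - pivot b *~ q) _ Wxq.
- by apply: subgroupB => //; exact: subgroupMz.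
- rewrite cxq (subgroup_additiveMz _ sW) //; last first.
    by move=> u v Wu Wv; have [] := c_additive Wu Wv.
  by rewrite qE mulrzz mulrC subrr.
by exists (D + << b >> *~ q); rewrite raddfD raddfMz /= lift1 DE subrK.
Qed.

Lemma free_criterion : free_subgroup H.
Proof.
exists B, (lift pivot); split.
  move=> D D' eqL; apply/eqP; rewrite -subr_eq0; apply/eqP/lift_pivot_inj.
  by rewrite raddfB /= eqL subrr.
apply/seteqP; split=> [_ [D _ <-]|x Hx]; first exact: lift_pivotH.
have [->|x_neq0] := pselect (x = 0); first by exists 0 => //; rewrite raddf0.
have [i Wx _] := c_lead Hx x_neq0.
by have [D DE] := lift_pivot_surj Hx Wx; exists D.
Qed.

End FreeCriterion.

(** * Reduction to groups of rank one *)

Definition solvable (C : zmodType) (a : nat -> nat) : Prop :=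
  forall c : nat -> C, exists x : nat -> C, forall n, x n - x n.+1 *+ a n = c n.

Section Extend.
Variables P C : zmodType.
Hypothesis C_solvable : forall a, (forall n, (0 < a n)%N) -> solvable C a.

(* A good [Gam] is the graph of a homomorphism from a pure subgroup of [P]. *)
Definition graph_dom (Gam : set (P * C)) : set P := [set p | exists c, Gam (p, c)].

Definition good_graph (Gam : set (P * C)) : Prop :=
  [/\ is_subgroup Gam, forall c, Gam (0, c) -> c = 0 &
      forall p n, (0 < n)%N -> graph_dom Gam (p *+ n) -> graph_dom Gam p].

Lemma graph_dom_subgroup Gam : is_subgroup Gam -> is_subgroup (graph_dom Gam).
Proof.
move=> sG; split; first by exists 0; exact: (subgroup0 sG).
by move=> p q [c pc] [d qd]; exists (c - d); exact: (subgroupB sG pc qd).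
Qed.

Lemma mulrz_pair (w : P * C) n : w *~ n = (w.1 *~ n, w.2 *~ n).
Proof. by rewrite [LHS]surjective_pairing; congr (_, _); rewrite raddfMz. Qed.

Section OneStep.
Variables (Gam : set (P * C)) (x : P).
Hypotheses (goodG : good_graph Gam) (xG : ~ graph_dom Gam x).

Let S := graph_dom Gam.
Let sG : is_subgroup Gam. Proof. by case: goodG. Qed.
Let sS : is_subgroup S. Proof. exact: graph_dom_subgroup. Qed.
Let pureS p n : (0 < n)%N -> S (p *+ n) -> S p.
Proof. by case: goodG => _ _ pure; exact: pure. Qed.

Let S_x0 z : S (x *~ z) -> z = 0.
Proof.
case: z => [[//|n]|n] Sx; case: xG.
  exact: (pureS (ltn0Sn n) Sx).
apply: (pureS (ltn0Sn n)).
by have := subgroupN sS Sx; rewrite NegzE mulrNz opprK.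
Qed.

Let gen n : exists gp : nat * P, [/\ (0 < gp.1)%N, S (gp.2 *+ n`! - x *+ gp.1) &
  forall p z, S (p *+ n`! - x *~ z) -> exists q, z = q * gp.1%:Z].
Proof.
have [||d [[p Sp] d_gt0 dP]] :=
    @int_subgroup_generator (fun z => exists p, S (p *+ n`! - x *~ z)).
- split; first by exists 0; rewrite mul0rn mulr0z subr0; exact: subgroup0.
  move=> z z' [p Sp] [p' Sp']; exists (p - p').
  have := subgroupB sS Sp Sp'; rewrite opprB addrA addrAC -!addrA.
  by rewrite mulrnBl mulrzBr opprB addrCA addrC -!addrA.
- by exists n`!%:Z; [exists x; rewrite subrr; exact: subgroup0|rewrite eqz_nat -lt0n fact_gt0].
by exists (d, p); split=> // p' z Sp'; apply: dP; exists p'.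
Qed.

Lemma good_graph_extend : exists Gam', [/\ good_graph Gam', Gam `<=` Gam' & graph_dom Gam' x].
Proof.
have [gp gpP] := choice gen.
pose g n := (gp n).1; pose X n := (gp n).2.
have g_gt0 n : (0 < g n)%N by case: (gpP n).
have XS n : S (X n *+ n`! - x *+ g n) by case: (gpP n).
have gP n p z : S (p *+ n`! - x *~ z) -> exists q, z = q * (g n)%:Z.
  by case: (gpP n) => _ _; apply.
have XSn n : S (X n *+ n.+1`! - x *+ (g n * n.+1)).
  have := subgroupMz n.+1 sS (XS n).
  by rewrite -pmulrn mulrnBl -!mulrnA factS mulnC.
have [a aP] : {a : nat -> nat & forall n, (g n * n.+1 = a n * g n.+1)%N}.
  apply: (@choice _ _ (fun n m => (g n * n.+1 = m * g n.+1)%N)) => n.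
  have [[q|q] qE] := gP n.+1 (X n) (g n * n.+1)%N (XSn n).
    by exists q; apply/eqP; rewrite -eqz_nat qE.
  exfalso; move: qE; rewrite NegzE mulNr => /eqP.
  by rewrite -PoszM eq_sym eqr_oppLR -subr_eq0 opprK -PoszD
    eqz_nat addn_eq0 !muln_eq0 !eqn0Ngt g_gt0.
have a_gt0 n : (0 < a n)%N.
  by have := ltn0Sn n; rewrite -(ltn_pmul2l (g_gt0 n)) muln0 aP muln_gt0 => /andP[].
have Xa n : S (X n - X n.+1 *+ a n).
  apply: (pureS (fact_gt0 n.+1)).
  have := subgroupB sS (XSn n) (subgroupMz (a n) sS (XS n.+1)).
  rewrite -pmulrn [X in _ - X]mulrnBl -!mulrnA [(g n.+1 * _)%N]mulnC -aP opprB addrA subrK.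
  by rewrite mulrnBl -mulrnA [(a n * _)%N]mulnC.
have [c cP] := choice Xa.
have [u uP] := C_solvable a_gt0 c.
pose Y n : P * C := (X n, u n).
have Ya n : Gam (Y n - Y n.+1 *~ a n).
  by have := cP n; rewrite -uP mulrz_pair.
pose Gam' : set (P * C) := [set w | exists n q, Gam (w - Y n *~ q)].
have raise m n w q : Gam (w - Y n *~ q) -> exists q', Gam (w - Y (n + m)%N *~ q').
  elim: m q => [|m IH] q Gw; first by exists q; rewrite addn0.
  have [q' Gq'] := IH q Gw; exists ((a (n + m)%N)%:Z * q').
  have := subgroupD sG Gq' (subgroupMz q' sG (Ya (n + m)%N)).
  by rewrite mulrzBl addrA subrK addnS mulrzA.
have inG' p n z : S (p *+ n`! - x *~ z) -> graph_dom Gam' p.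
  move=> Sp; have [q zE] := gP _ _ _ Sp.
  have [d pd] : S (p - X n *~ q).
    apply: (pureS (fact_gt0 n)).
    have := subgroupB sS Sp (subgroupMz q sS (XS n)).
    by rewrite zE !pmulrn !mulrzBl -!mulrzA !(mulrC q) opprB addrA subrK.
  exists (d + u n *~ q), n, q.
  suff -> : (p, d + u n *~ q) - Y n *~ q = (p - X n *~ q, d) by [].
  by rewrite mulrz_pair; congr (_, _); rewrite addrK.
exists Gam'; split; last first.
- by apply: (inG' x 0%N 1); rewrite mulr1n mulr1z subrr; exact: subgroup0.
- by move=> w Gw; exists 0%N, 0; rewrite mulr0z subr0.
split.
- split; first by exists 0%N, 0; rewrite mulr0z subr0; exact: subgroup0.
  move=> w w' [n [q Gw]] [n' [q' Gw']].
  have [r Gr] := raise n' n w q Gw; have [r' Gr'] := raise n n' w' q' Gw'.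
  exists (n + n')%N, (r - r'); rewrite [(n' + n)%N]addnC in Gr'.
  have := subgroupB sG Gr Gr'; congr Gam.
  by rewrite mulrzBr !opprB addrACA [RHS]addrACA [- w' + _]addrC.
- move=> d [n [q Gd]].
  suff q0 : q = 0 by move: Gd; rewrite q0 mulr0z subr0; case: goodG => _ fun0 _; exact: fun0.
  have SXq : S (X n *~ q).
    rewrite -[X n *~ q]opprK; apply: subgroupN => //; exists (d - u n *~ q).
    by move: Gd; rewrite mulrz_pair; congr Gam; congr (_, _); rewrite sub0r.
  have : S (x *~ ((g n)%:Z * q)).
    have := subgroupB sS (subgroupMz n`! sS SXq) (subgroupMz q sS (XS n)).
    by rewrite !pmulrn mulrzBl -!mulrzA !(mulrC q) opprB addrC subrK.
  by move=> /S_x0/eqP; rewrite mulf_eq0 eqz_nat eqn0Ngt g_gt0 => /eqP.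
move=> p m m_gt0 [d [n [q Gd]]].
have Sp : S (p *+ m - X n *~ q).
  by exists (d - u n *~ q); move: Gd; rewrite mulrz_pair.
have [t tE] : exists t, ((m + n)`! = m * n`! * t)%N.
  case: m m_gt0 {Gd Sp} => // m _.
  exists (m`! * 'C(m.+1 + n, n))%N; rewrite -(bin_fact (leq_addl m.+1 n)) addnK factS.
  by rewrite [LHS]mulnC mulnCA !mulnA.
apply: (inG' p (m + n)%N ((g n)%:Z * q * t%:Z)).
have -> : p *+ (m + n)`! - x *~ ((g n)%:Z * q * t%:Z) =
    (p *+ m - X n *~ q) *~ (n`! * t)%N + (X n *+ n`! - x *+ g n) *~ (q * t%:Z).
  rewrite !mulrzBl tE !pmulrn -!mulrzA addrA.
  have -> : q * (n`! * t)%N%:Z = n`!%:Z * (q * t%:Z) by rewrite PoszM mulrCA.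
  by rewrite subrK mulrA -PoszM mulnA.
by apply: subgroupD => //; exact: subgroupMz.
Qed.

End OneStep.
Lemma extend_from_pure (A : set P) (f : P -> C) : is_subgroup A ->
  (forall p n, (0 < n)%N -> A (p *+ n) -> A p) ->
  (forall p q, A p -> A q -> f (p - q) = f p - f q) ->
  exists h : {additive P -> C}, forall p, A p -> h p = f p.
Proof.
move=> sA pureA fB.
pose base : set (P * C) := [set w | A w.1 /\ w.2 = f w.1].
have f0 : f 0 = 0 by have A0 := subgroup0 sA; rewrite -(subrr 0) fB // subrr.
have good_base : good_graph base.
  split.
  - split; first by split; [exact: (subgroup0 sA)|rewrite /= f0].
    move=> w w' [Aw wE] [Aw' wE']; split; first exact: subgroupB.
    by rewrite /= wE wE' fB.
  - by move=> c [_ /= ->].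
  - by move=> p n n_gt0 [c [/= Ap _]]; exists (f p); split=> //=; exact: pureA Ap.
have [|Z [goodZ Zmax]] := @Zorn_bigcup _ (fun Z => good_graph (base `|` Z)).
  move=> F Fgood Ftot.
  have [[Z0 FZ0]|F0] := pselect (exists Z, F Z); last first.
    suff -> : base `|` \bigcup_(Z in F) Z = base by [].
    apply/seteqP; split=> [w [//|[Z FZ _]]|w]; last by left.
    by case: F0; exists Z.
  have cover w : (base `|` \bigcup_(Z in F) Z) w -> exists2 Z, F Z & (base `|` Z) w.
    by move=> [bw|[Z FZ Zw]]; [exists Z0 => //; left|exists Z => //; right].
  have coverI Z w : F Z -> (base `|` Z) w -> (base `|` \bigcup_(Z in F) Z) w.
    by move=> FZ [bw|Zw]; [left|right; exists Z].
  have cover2 w w' : (base `|` \bigcup_(Z in F) Z) w -> (base `|` \bigcup_(Z in F) Z) w' ->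
      exists Z, [/\ F Z, (base `|` Z) w & (base `|` Z) w'].
    move=> /cover[Z FZ Zw] /cover[Z' FZ' Z'w'].
    have [ZZ'|Z'Z] := Ftot Z Z' FZ FZ'.
      by exists Z'; split=> //; case: Zw => [bw|/ZZ']; [left|right].
    by exists Z; split=> //; case: Z'w' => [bw|/Z'Z]; [left|right].
  split.
  - split; first by apply: (coverI Z0) => //; case: (Fgood _ FZ0) => sZ _ _; exact: subgroup0.
    move=> w w' Zw Zw'; have [Z [FZ {}Zw {}Zw']] := cover2 w w' Zw Zw'.
    by apply: (coverI Z) => //; case: (Fgood _ FZ) => sZ _ _; exact: subgroupB.
  - by move=> c /cover[Z /Fgood[_ Zfun _] Zc]; exact: Zfun.
  - move=> p n n_gt0 [c /cover[Z FZ Zc]].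
    have [_ _ Zpure] := Fgood _ FZ; have [d Zd] := Zpure p n n_gt0 (ex_intro _ c Zc).
    by exists d; exact: (coverI Z).
set Gam := base `|` Z in goodZ.
have total p : graph_dom Gam p.
  apply: contrapT => nGp.
  have [Gam' [goodG' sub' Gp]] := good_graph_extend goodZ nGp.
  apply: (Zmax Gam'); last first.
    suff -> : base `|` Gam' = Gam' by [].
    by apply/seteqP; split=> [w [bw|//]|w]; [apply: sub'; left|right].
  split=> [w Zw|sub]; first by apply: sub'; right.
  by case: nGp; case: Gp => c /sub Zc; exists c; right.
have [sG funG _] := goodZ.
have [h hP] := choice total.
have uniqG p c d : Gam (p, c) -> Gam (p, d) -> c = d.
  move=> Gc Gd; apply/eqP; rewrite -subr_eq0; apply/eqP/funG.
  by have := subgroupB sG Gc Gd; congr Gam; congr (_, _); rewrite subrr.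
have hB : zmod_morphism h.
  by move=> p q; apply: uniqG (hP _) _; exact: (subgroupB sG (hP p) (hP q)).
pose ha := GRing.isZmodMorphism.Build P C h hB.
pose h' : {additive P -> C} := HB.pack h ha.
by exists h' => p Ap; apply: uniqG (hP p) _; left.
Qed.

End Extend.

Lemma torsion_free_ext0 (F C : zmodType) :
  (forall a, (forall n, (0 < a n)%N) -> solvable C a) ->
  torsion_free F -> forall e : Ext F C, e = 0.
Proof.
move=> solC tfF; apply/ext0P => f fB.
pose A : set {freeg F / int} := [set D | D \in @rel_pred F].
pose fA (D : {freeg F / int}) : C :=
  if insub D is Some r then f r else 0.
have fAE (r : relations F) : fA (rel_val r) = f r by rewrite /fA valK.
have inA D : A D -> exists r : relations F, rel_val r = D.
  by move=> AD; exists (MkRelation AD).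
have [|||h hP] := @extend_from_pure _ C solC A fA.
- by split=> [|D D' AD AD']; [exact: rpred0|exact: rpredB].
- move=> D n n_gt0 /eqP; rewrite raddfMn => /(tfF _ _ n_gt0) D0.
  by apply/eqP.
- move=> _ _ /inA[r <-] /inA[r' <-].
  by rewrite -[_ - _]/(rel_val (r - r')) !fAE fB.
by exists h => r; rewrite hP ?fAE //; case: r.
Qed.

(** * The group attached to a branching system *)

Section Functionals.
Variables (K : Type) (V : zmodType).

Definition evalf (x : K) (f : K -> V) : V := f x.

Fact evalfB x : zmod_morphism (evalf x).
Proof. by []. Qed.

HB.instance Definition _ x :=
  GRing.isZmodMorphism.Build (K -> V) V (evalf x) (evalfB x).

Lemma fctMn (f : K -> V) n x : (f *+ n) x = f x *+ n.
Proof. exact: (raddfMn (evalf x)). Qed.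

Lemma fct_sum (I : Type) (s : seq I) (P : pred I) (F : I -> K -> V) x :
  (\sum_(i <- s | P i) F i) x = \sum_(i <- s | P i) F i x.
Proof. exact: (raddf_sum (evalf x)). Qed.

End Functionals.

Section TailProd.
Variable a : nat -> nat.
Hypothesis a_gt0 : forall n, (0 < a n)%N.

Definition aprod n i : nat := (\prod_(n <= j < i) a j)%N.

Lemma aprodnn n : aprod n n = 1%N.
Proof. by rewrite /aprod big_geq. Qed.

Lemma aprodSr n i : (n <= i)%N -> aprod n i.+1 = (aprod n i * a i)%N.
Proof. by move=> ni; rewrite /aprod big_nat_recr. Qed.

Lemma aprodSl n i : (n < i)%N -> aprod n i = (a n * aprod n.+1 i)%N.
Proof. by move=> ni; rewrite /aprod big_ltn. Qed.

Lemma aprod_cat n m i : (n <= m)%N -> (m <= i)%N ->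
  aprod n i = (aprod n m * aprod m i)%N.
Proof. by move=> nm mi; rewrite /aprod (big_cat_nat nm mi). Qed.

Lemma aprod_gt0 n i : (0 < aprod n i)%N.
Proof. by rewrite /aprod prodn_cond_gt0. Qed.

End TailProd.

Section BranchGroup.
Variables (S : branching) (a : nat -> nat).

Local Notation V := (Key S -> int).

Definition delta (x : Key S) : V := fun y => `[< y = x >]%:R.

Definition tail (eta : Node S) (n : nat) : V := fun x =>
  if `[< exists i, x = key i (lev x) eta >] && (n <= lev x)%N
  then (aprod a n (lev x))%:Z else 0.

Definition branch_gens (W : set (Node S)) : set V :=
  [set v | (exists x, v = delta x) \/ exists eta n, W eta /\ v = tail eta n].

Definition branch_group : zmodType := span_type (branch_gens setT).

Lemma delta_eq x : delta x x = 1.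
Proof. by rewrite /delta asboolT. Qed.

Lemma delta_neq x y : y <> x -> delta x y = 0.
Proof. by move=> neq; rewrite /delta asboolF. Qed.

Lemma tail_key eta n i m :
  tail eta n (key i m eta) = if (n <= m)%N then (aprod a n m)%:Z else 0.
Proof. by rewrite /tail key_lev asboolT //; exists i. Qed.

Lemma tail_off eta n x : (forall i, x <> key i (lev x) eta) -> tail eta n x = 0.
Proof. by move=> off; rewrite /tail asboolF // => -[i /off]. Qed.

Lemma tail_step eta n :
  tail eta n - tail eta n.+1 *+ a n = \sum_i delta (key i n eta).
Proof.
apply: functional_extensionality_dep => x; rewrite fct_sum.
have -> : (tail eta n - tail eta n.+1 *+ a n) x = tail eta n x - tail eta n.+1 x *+ a n.
  by rewrite -(fctMn (tail eta n.+1)); exact: (evalfB x).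
have [[i ->]|off] := pselect (exists i, x = key i (lev x) eta); last first.
  rewrite !tail_off ?mul0rn ?subrr ?big1 // => i; do ?by move=> xi; apply: off; exists i.
  move=> _; apply: delta_neq => xi; apply: off; exists i.
  by rewrite {2}xi key_lev.
rewrite !tail_key; move: (lev x) => m; have [nm|mn] := leqP n m; last first.
  rewrite ltnNge (ltnW mn) /= mul0rn subrr big1 // => j _; apply: delta_neq => kij.
  by have := congr1 (@lev S) kij; rewrite !key_lev => mn'; rewrite mn' ltnn in mn.
move: nm; rewrite leq_eqVlt => /predU1P[<-|nm].
  rewrite ltnn mul0rn subr0 aprodnn (bigD1 i) //= delta_eq big1 ?addr0 // => j ji.
  by apply: delta_neq => /key_coord[ij _]; rewrite ij eqxx in ji.
rewrite nm aprodSl // -!natz natrM mulr_natl subrr big1 // => j _; apply: delta_neq => kij.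
by have := congr1 (@lev S) kij; rewrite !key_lev => mn'; rewrite mn' ltnn in nm.
Qed.

End BranchGroup.

(** * Freeness over an arranged set of nodes *)

Lemma wo_sum (T U : Type) (R : T -> T -> Prop) (Q : U -> U -> Prop) :
  is_wo R -> is_wo Q ->
  exists J : T + U -> T + U -> Prop, [/\ is_wo J, forall u x, ~ J (inr u) (inl x),
    (forall u v, J (inr u) (inr v) <-> Q u v) & forall x u, J (inl x) (inr u)].
Proof.
move=> Rwo Qwo.
pose J (p q : T + U) : Prop := match p, q with
  | inl x, inl y => R x y | inl _, inr _ => True
  | inr _, inl _ => False | inr u, inr v => Q u v end.
exists J; split; [split|by move=> u x; case|by split|by []].
  have accl x : Acc J (inl x).
    elim/(well_founded_ind Rwo.1): x => x IH; constructor.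
    by case=> [y Ryx|u []]; exact: IH.
  case=> [x|u]; first exact: accl.
  elim/(well_founded_ind Qwo.1): u => u IH; constructor.
  by case=> [y _|v Qvu]; [exact: accl|exact: IH].
case=> [x|u] [y|v].
- by case: (Rwo.2 x y) => [?|->|?]; [constructor 1|constructor 2|constructor 3].
- by constructor 1.
- by constructor 3.
- by case: (Qwo.2 u v) => [?|->|?]; [constructor 1|constructor 2|constructor 3].
Qed.

Lemma eval0_subgroup (K : Type) (x : K) : is_subgroup [set f : K -> int | f x = 0].
Proof.
split=> // f g /= fx gx; apply: etrans (evalfB x f g) _.
by rewrite /evalf fx gx subrr.
Qed.

Section ArrangedFree.
Variables (S : branching) (a : nat -> nat).
Hypothesis a_gt0 : forall n, (0 < a n)%N.
Variables (Om : set (Node S)) (lt : Node S -> Node S -> Prop).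
Variables (l : Node S -> Idx S) (N : Node S -> nat).
Hypothesis arr : arranged Om lt l N.

Local Notation V := (Key S -> int).
Local Notation J := (Key S + Node S)%type.

Let ltwo : is_wo lt. Proof. by case: arr. Qed.

(* The keys [spine eta i], [N eta <= i], belong to no earlier node; their
   coordinates detect the contribution of [eta]. *)
Let spine eta i : Key S := key (l eta) i eta.

Let owns eta x := [/\ Om eta, (N eta <= lev x)%N & x = spine eta (lev x)].

Let spine_lev eta i : lev (spine eta i) = i. Proof. exact: key_lev. Qed.

Let spine_neq eta nu i j m : Om eta -> Om nu -> lt nu eta -> (N eta <= i)%N ->
  spine eta i <> key j m nu.
Proof.
move=> Oeta Onu ltnu Ni e; have im : i = m by rewrite -[i](spine_lev eta) e key_lev.
move: e; rewrite -im => e; have [lj _] := key_coord e.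
by case: (arr.2 eta nu i Oeta Onu ltnu Ni); rewrite -/(spine eta i) e lj.
Qed.

Let owns_uniq eta nu x : owns eta x -> owns nu x -> eta = nu.
Proof.
move=> [Oeta Neta xeta] [Onu Nnu xnu].
case: (ltwo.2 eta nu) => [lten|//|ltne].
  by case: (spine_neq Onu Oeta lten Nnu (esym (etrans (esym xeta) xnu))).
by case: (spine_neq Oeta Onu ltne Neta (etrans (esym xeta) xnu)).
Qed.

Let rankP : {rk : Key S -> J & forall x,
  (exists2 eta, owns eta x & rk x = inr eta) \/
  (forall eta, ~ owns eta x) /\ rk x = inl x}.
Proof.
apply: (@choice _ _ (fun x j => (exists2 eta, owns eta x & j = inr eta) \/
  (forall eta, ~ owns eta x) /\ j = inl x)) => x.
have [[eta ox]|no] := pselect (exists eta, owns eta x).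
  by exists (inr eta); left; exists eta.
by exists (inl x); right; split=> // eta ox; apply: no; exists eta.
Qed.

Let rk : Key S -> J := projT1 rankP.

Let rk_owned eta x : owns eta x -> rk x = inr eta.
Proof.
move=> ox; case: (projT2 rankP x) => [[nu onu rkx]|[no _]]; last by case: (no eta).
by rewrite /rk rkx (owns_uniq ox onu).
Qed.

Let rk_inr eta x : rk x = inr eta -> owns eta x.
Proof.
rewrite /rk; case: (projT2 rankP x) => [[nu onu ->] [<-] //|[_ ->]]; by [].
Qed.

Let rk_inl x y : rk x = inl y -> x = y.
Proof. by rewrite /rk; case: (projT2 rankP x) => [[nu onu ->]|[_ ->] []]. Qed.

Let rk_spine eta i : Om eta -> (N eta <= i)%N -> rk (spine eta i) = inr eta.
Proof. by move=> Oeta Ni; apply: rk_owned; split; rewrite ?spine_lev. Qed.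

Let gen (j : J) : set V := [set v | (exists2 x, v = delta x & rk x = j) \/
  exists eta n, [/\ Om eta, v = tail a eta n & j = inr eta]].

Section WithOrder.
Variable R : J -> J -> Prop.
Hypothesis Rwo : is_wo R.
Hypothesis R_rl : forall u x, ~ R (inr u) (inl x).
Hypothesis R_rr : forall u v, R (inr u) (inr v) <-> lt u v.
Hypothesis R_lr : forall x u, R (inl x) (inr u).

Let Mle j : set V := span [set v | exists2 i, wo_le R i j & gen i v].
Let Mlt j : set V := span [set v | exists2 i, R i j & gen i v].

Let Mlt_sub i : is_subgroup (Mlt i). Proof. exact: span_subgroup. Qed.
Let Mle_sub i : is_subgroup (Mle i). Proof. exact: span_subgroup. Qed.

Let Mle_mono i j : wo_le R i j -> Mle i `<=` Mle j.
Proof.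
move=> ij; apply: span_sub => v [k ki gv]; exists k => //.
exact: wo_le_trans Rwo _ _ _ ki ij.
Qed.

Let Mle_lt i j : R i j -> Mle i `<=` Mlt j.
Proof.
move=> ij; apply: span_sub => v [k ki gv]; exists k => //.
exact: (wo_le_lt_trans Rwo) ki ij.
Qed.

Let span_Mle (D : set J) x : span [set v | exists2 i, D i & gen i v] x ->
  x = 0 \/ exists2 i, D i & Mle i x.
Proof.
move=> sx; apply: (sx [set x | x = 0 \/ exists2 i, D i & Mle i x]); last first.
  move=> v [i Di gv]; right; exists i => //; apply: sub_span; exists i => //.
  by right.
split; first by left.
move=> y z [->|[i Di Miy]] [->|[j Dj Mjz]].
- by left; rewrite subrr.
- by right; exists j => //; rewrite sub0r; exact: (subgroupN (Mle_sub j)).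
- by right; exists i => //; rewrite subr0.
- right; have [ij|ji] := wo_le_total Rwo i j.
    by exists j => //; apply: (subgroupB (Mle_sub j)) => //; exact: Mle_mono ij _ Miy.
  by exists i => //; apply: (subgroupB (Mle_sub i)) => //; exact: Mle_mono ji _ Mjz.
Qed.

(* The [s]-th coordinate of the quotient [Mle j / Mlt j]. *)
Let coordf (j : J) (s : nat) (f : V) : int :=
  match j, s with
  | inl x, 0 => f x
  | inl _, _.+1 => 0
  | inr eta, 0 => if `[< Om eta >] then f (spine eta (N eta)) else 0
  | inr eta, t.+1 => if `[< Om eta >] then
      f (spine eta (N eta + t.+1)) - f (spine eta (N eta + t)) *+ a (N eta + t) else 0
  end.

Let coordfB j s : zmod_morphism (coordf j s).
Proof.
case: j s => [x|eta] [|s] f g; rewrite /coordf.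
- by [].
- by rewrite subrr.
- by case: ifP => _; rewrite ?subrr.
case: ifP => _; last by rewrite subrr.
rewrite -[(f - g) _]/(f _ - g _) -[(f - g) (spine eta (N eta + s))]/(f _ - g _).
by rewrite mulrnBl subrBB.
Qed.

Let Mlt_spine eta i f : Om eta -> (N eta <= i)%N -> Mlt (inr eta) f -> f (spine eta i) = 0.
Proof.
move=> Oeta Ni Mf; apply: (Mf _ (eval0_subgroup (spine eta i))).
move=> g [j Rj [[x -> rkx]|[nu [n [Onu -> je]]]]].
  apply: delta_neq => xe; move: Rj; rewrite -rkx -xe rk_spine //.
  exact: wo_irr.
apply: tail_off => k; apply: spine_neq => //; apply/R_rr.
by rewrite -je.
Qed.

Let Mlt_key x f : Mlt (inl x) f -> f x = 0.
Proof.
move=> Mf; apply: (Mf _ (eval0_subgroup x)).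
move=> g [j Rj [[y -> rky]|[nu [n [_ _ je]]]]];
  last by case: (R_rl (u := nu) (x := x)); rewrite -je.
case: j Rj rky => [z|nu] Rz rky; last by case: (R_rl Rz).
apply: delta_neq => xy; move: Rz; rewrite xy -(rk_inl rky).
exact: wo_irr.
Qed.

Let coordf_Mlt j s f : Mlt j f -> coordf j s f = 0.
Proof.
case: j s => [x|eta] [|s] //= Mf; first exact: Mlt_key.
  by case: asboolP => // Oeta; exact: Mlt_spine.
case: asboolP => // Oeta.
by rewrite !Mlt_spine ?leq_addr // mul0rn subrr.
Qed.

Let Mle_key x f : Mle (inl x) f -> Mlt (inl x) (f - delta x *~ f x).
Proof.
move=> Mf; apply: (Mf [set f | Mlt (inl x) (f - delta x *~ f x)]); first split.
- by rewrite /= mulr0z subr0; exact: subgroup0 (Mlt_sub _).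
- move=> g h Pg Ph; rewrite /= -[(g - h) x]/(g x - h x).
  have := subgroupB (Mlt_sub _) Pg Ph; congr (Mlt _).
  by rewrite mulrzBr subrBB.
move=> g [j [Rj|je] gj] /=.
  have Mg : Mlt (inl x) g by apply: sub_span; exists j.
  by rewrite (Mlt_key Mg) mulr0z subr0.
case: gj => [[y -> rky]|[nu [n [_ _]]]]; last by rewrite je.
move: rky; rewrite je => /rk_inl ->.
by rewrite delta_eq mulr1z subrr; exact: subgroup0 (Mlt_sub _).
Qed.

(* Below [inr eta], up to [Mlt], every element is an integral combination of one
   tail of [eta] and of finitely many deltas on its spine. *)
Let form eta n : set V := [set f | exists b : int,
  (forall i, (N eta <= i)%N -> (n <= i)%N -> f (spine eta i) = (aprod a n i)%:Z * b) /\
  Mlt (inr eta) (f - tail a eta n *~ b -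
    \sum_(N eta <= i < n) delta (spine eta i) *~ f (spine eta i))].

Let form_sub eta n : is_subgroup (form eta n).
Proof.
split.
  exists 0; split=> [i _ _|]; first by rewrite mulr0.
  rewrite mulr0z big1 ?subr0 => [|i _]; [exact: subgroup0 (Mlt_sub _)|exact: mulr0z].
move=> g h [b [gb Mg]] [b' [hb Mh]]; exists (b - b'); split=> [i Ni ni|].
  by rewrite -[(g - h) _]/(g _ - h _) gb // hb // mulrBr.
have := subgroupB (Mlt_sub _) Mg Mh; congr (Mlt _).
have -> : \sum_(N eta <= i < n) delta (spine eta i) *~ (g - h) (spine eta i) =
  \sum_(N eta <= i < n) delta (spine eta i) *~ g (spine eta i) -
  \sum_(N eta <= i < n) delta (spine eta i) *~ h (spine eta i).
  by rewrite -sumrB; apply: eq_bigr => i _; rewrite -mulrzBr.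
by rewrite mulrzBr subrBB; congr (_ - _); exact: subrBB.
Qed.

Let key_Mlt eta i n : Om eta -> (i != l eta) || (n < N eta)%N ->
  Mlt (inr eta) (delta (key i n eta)).
Proof.
move=> Oeta off; apply: sub_span; exists (rk (key i n eta)); last by left; exists (key i n eta).
rewrite /rk; case: (projT2 rankP (key i n eta)) => [[nu onu ->]|[_ ->]]; last exact: R_lr.
apply/R_rr; have [Onu Nnu kE] := onu.
case: (ltwo.2 nu eta) => [//|e|lten].
  rewrite e !key_lev in kE Nnu; case/orP: off; last by rewrite ltnNge Nnu.
  by have [-> _] := key_coord kE; rewrite eqxx.
by case: (spine_neq Onu Oeta lten Nnu (esym kE)).
Qed.

Let form_step eta n f : Om eta -> form eta n f -> form eta n.+1 f.
Proof.
move=> Oeta [b [fb Mf]]; exists ((a n)%:Z * b); split=> [i Ni ni|].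
  by rewrite fb ?(ltnW ni) // aprodSl // PoszM mulrA [_ * (a n)%:Z]mulrC.
have tailE : tail a eta n *~ b =
    tail a eta n.+1 *~ ((a n)%:Z * b) + (\sum_i delta (key i n eta)) *~ b.
  by rewrite -(tail_step a) mulrzBl pmulrn -mulrzA addrC subrK.
have [Nn|nN] := leqP (N eta) n; last first.
  have -> : f - tail a eta n.+1 *~ ((a n)%:Z * b) -
      \sum_(N eta <= i < n.+1) delta (spine eta i) *~ f (spine eta i) =
      f - tail a eta n *~ b - \sum_(N eta <= i < n) delta (spine eta i) *~ f (spine eta i)
      + (\sum_i delta (key i n eta)) *~ b.
    by rewrite !big_geq ?(ltnW nN) // !subr0 tailE opprD addrA subrK.
  apply: (subgroupD (Mlt_sub _)) => //; apply: (subgroupMz _ (Mlt_sub _)).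
  apply: (subgroup_sum (Mlt_sub _)) => i _ _.
  by apply: key_Mlt => //; rewrite nN orbT.
have -> : f - tail a eta n.+1 *~ ((a n)%:Z * b) -
    \sum_(N eta <= i < n.+1) delta (spine eta i) *~ f (spine eta i) =
    f - tail a eta n *~ b - \sum_(N eta <= i < n) delta (spine eta i) *~ f (spine eta i)
    + (\sum_(i | i != l eta) delta (key i n eta)) *~ b.
  rewrite tailE (bigD1 (l eta)) //= big_nat_recr //= fb // aprodnn mul1r -/(spine eta n).
  by rewrite mulrzDl !opprD !addrA [RHS]addrAC subrK [LHS]addrAC.
apply: (subgroupD (Mlt_sub _)) => //; apply: (subgroupMz _ (Mlt_sub _)).
apply: (subgroup_sum (Mlt_sub _)) => i _ il.
by apply: key_Mlt => //; rewrite il.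
Qed.

Let gen_form eta j v : Om eta -> wo_le R j (inr eta) -> gen j v -> exists n, form eta n v.
Proof.
move=> Oeta [Rj|->] gv.
  have Mv : Mlt (inr eta) v by apply: sub_span; exists j.
  have v0 i : (N eta <= i)%N -> v (spine eta i) = 0 by move=> Ni; exact: Mlt_spine.
  exists 0%N, 0; split=> [i Ni _|]; first by rewrite v0 // mulr0.
  by rewrite mulr0z big_geq // !subr0.
case: gv => [[x -> rkx]|[nu [n [Onu -> [<-]]]]].
  have [_ Nx xE] := rk_inr rkx; move: (lev x) Nx xE => i Ni ->.
  have spine_inj k : k != i -> spine eta k <> spine eta i.
    by move=> ki e; move: ki; rewrite -(spine_lev eta k) e spine_lev eqxx.
  exists i.+1, 0; split=> [k _ ik|].
    by rewrite mulr0 delta_neq //; apply: spine_inj; rewrite gtn_eqF.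
  rewrite mulr0z subr0 big_nat_recr //= delta_eq mulr1z big_nat big1 ?add0r ?subrr.
    exact: subgroup0 (Mlt_sub _).
  by move=> k /andP[_ ki]; rewrite delta_neq ?mulr0z //; apply: spine_inj; rewrite ltn_eqF.
exists n, 1; split=> [i Ni ni|]; first by rewrite tail_key ni mulr1.
rewrite mulr1z subrr big_nat big1 ?subrr; first exact: subgroup0 (Mlt_sub _).
by move=> i /andP[_ ni]; rewrite tail_key leqNgt ni mulr0z.
Qed.

Let Mle_form eta f : Om eta -> Mle (inr eta) f -> exists n, form eta n f.
Proof.
move=> Oeta Mf.
have up m n g : form eta n g -> form eta (n + m)%N g.
  by move=> gn; elim: m => [|m IH]; [rewrite addn0|rewrite addnS; exact: form_step].
apply: (Mf [set f | exists n, form eta n f]); last first.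
  by move=> v [j jeta gv]; exact: gen_form gv.
split; first by exists 0%N; exact: subgroup0 (form_sub _ _).
move=> g h [n gn] [m hm]; exists (n + m)%N.
apply: (subgroupB (form_sub _ _)); first exact: up.
by rewrite addnC; exact: up.
Qed.

Let Mle_unused eta f : ~ Om eta -> Mle (inr eta) f -> Mlt (inr eta) f.
Proof.
move=> nO; apply: span_sub => v [j [Rj gv|-> gv]]; first by exists j.
case: gv => [[x _ /rk_inr[Oeta]]|[nu [n [Onu _ [e]]]]]; first by case: nO.
by case: nO; rewrite e.
Qed.

Let coordf_finite j f : Mle j f -> exists s0, forall s, (s0 <= s)%N -> coordf j s f = 0.
Proof.
case: j => [x|eta] Mf; first by exists 1%N => -[].
have [Oeta|nO] := pselect (Om eta); last first.
  by exists 0%N => s _; apply: coordf_Mlt; exact: Mle_unused.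
have [n [b [fb _]]] := Mle_form Oeta Mf.
exists n.+1 => -[//|s] ns; rewrite /= asboolT //.
have nNs : (n <= N eta + s)%N by apply: (@leq_trans s); [exact: ns|exact: leq_addl].
rewrite addnS !fb ?leqW ?leq_addr // aprodSr // PoszM.
by rewrite -mulrA [(a _)%:Z * b]mulrC mulrA -[(a _)%:Z]natz mulr_natr subrr.
Qed.

Let coordf_eq0 j f : Mle j f -> (forall s, coordf j s f = 0) -> Mlt j f.
Proof.
case: j => [x|eta] Mf c0.
  by have := Mle_key Mf; have /= -> := c0 0%N; rewrite mulr0z subr0.
have [Oeta|nO] := pselect (Om eta); last exact: Mle_unused.
have [n [b [fb Mfb]]] := Mle_form Oeta Mf.
have f0 s : f (spine eta (N eta + s)) = 0.
  elim: s => [|s IH]; first by have := c0 0%N; rewrite /= asboolT // addn0.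
  by have := c0 s.+1; rewrite /= asboolT // IH mul0rn subr0.
have {}f0 i : (N eta <= i)%N -> f (spine eta i) = 0 by move=> /subnKC <-.
have b0 : b = 0.
  apply/eqP; have := fb (n + N eta)%N (leq_addl _ _) (leq_addr _ _).
  by rewrite f0 ?leq_addl // => /esym/eqP; rewrite mulf_eq0 eqz_nat eqn0Ngt aprod_gt0.
move: Mfb; rewrite b0 mulr0z subr0 big_nat big1 ?subr0 // => i /andP[Ni _].
by rewrite f0 // mulr0z.
Qed.

Lemma arranged_free_wo (H : set (branch_group S a)) : is_subgroup H ->
  (forall x, H x -> span (branch_gens a Om) (span_val x)) -> free_subgroup H.
Proof.
move=> sH HOm.
pose W (i : J * nat) : set (branch_group S a) :=
  [set x | Mle i.1 (span_val x) /\ forall t, (i.2 < t)%N -> coordf i.1 t (span_val x) = 0].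
pose c (i : J * nat) (x : branch_group S a) := coordf i.1 i.2 (span_val x).
pose RL (i i' : J * nat) := R i.1 i'.1 \/ i.1 = i'.1 /\ (i.2 < i'.2)%N.
have RLwo : is_wo RL.
  apply: (@wo_lex _ _ R (fun _ i i' => (i.2 < i'.2)%N) fst Rwo).
    by move=> _; exact: (wf_image snd wo_ltn.1).
  move=> [j s] [j' s'] /= <-.
  by case: (ltngtP s s') => [?|?|->]; [constructor 1|constructor 3|constructor 2].
apply: (@free_criterion _ H _ RL W c sH RLwo).
- move=> x Hx x_neq0; have fx_neq0 : span_val x <> 0.
    by move=> fx0; apply: x_neq0; apply: val_inj.
  have [//|[j0 _ Mj0]] : span_val x = 0 \/ exists2 j, setT j & Mle j (span_val x).
    apply: span_Mle; apply: span_sub (HOm x Hx) => v [[y ->]|[eta [n [Oeta ->]]]].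
      by exists (rk y) => //; left; exists y.
    by exists (inr eta) => //; right; exists eta, n.
  have [j Mj jmin] := wo_min Rwo (ex_intro (fun j => Mle j (span_val x)) j0 Mj0).
  have [s0 s0P] := coordf_finite Mj.
  have [[s cs]|call0] := pselect (exists s, coordf j s (span_val x) != 0); last first.
    have /span_Mle[//|[i Rij Mi]] : Mlt j (span_val x).
      apply: coordf_eq0 => // s; apply/eqP; apply: contrapT => /negP cs.
      by apply: call0; exists s.
    by case: (jmin i Rij).
  have exs : exists s, coordf j s (span_val x) != 0 by exists s.
  have bnd t : coordf j t (span_val x) != 0 -> (t <= s0)%N.
    by move=> ct; rewrite leqNgt; apply: contra_neqN ct => /ltnW/s0P.
  have [m cm mmax] := ex_maxnP exs bnd.
  exists (j, m) => //; split=> // t /= mt; apply/eqP; apply: contraTT mt => /mmax.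
  by rewrite -leqNgt.
- move=> [j s] x y [/= Mx cx] [My cy]; split; last exact: coordfB.
  split; first exact: (subgroupB (Mle_sub j) Mx My).
  by move=> t st; rewrite /= (coordfB j t) cx // cy // subrr.
move=> [j s] [j' s'] x [/= Rj|[/= jj' ss']] [/= Mx cx].
  have Mltx : Mlt j (span_val x) by exact: Mle_lt Rj _ Mx.
  split; last exact: coordf_Mlt.
  split; last by move=> t _; exact: coordf_Mlt.
  by apply: Mle_mono Mx; left.
rewrite -jj'; split; last exact: cx.
by split=> // t /= st; apply: cx; exact: ltn_trans st.
Qed.

End WithOrder.

Lemma arranged_free (H : set (branch_group S a)) : is_subgroup H ->
  (forall x, H x -> span (branch_gens a Om) (span_val x)) -> free_subgroup H.
Proof.
have [RK RKwo] := wo_exists (Key S).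
have [R [Rwo R_rl R_rr R_lr]] := wo_sum RKwo ltwo.
exact: (@arranged_free_wo R Rwo R_rl R_rr R_lr).
Qed.

End ArrangedFree.

Section BranchGroupAlephFree.
Variables (S : branching) (a : nat -> nat) (j : nat).
Hypothesis a_gt0 : forall n, (0 < a n)%N.
Hypothesis card_Idx : #|Idx S| = j.+1.

Lemma span_countable_nodes (f : Key S -> int) : span (branch_gens a setT) f ->
  exists2 W : set (Node S), countable W & span (branch_gens a W) f.
Proof.
have mono (W W' : set (Node S)) : W `<=` W' -> branch_gens a W `<=` branch_gens a W'.
  move=> WW' v [[x ->]|[eta [n [Weta ->]]]]; first by left; exists x.
  by right; exists eta, n; split=> //; exact: WW'.
move=> sf; apply: (sf [set f | exists2 W, countable W & span (branch_gens a W) f]).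
  split; first by exists set0; [exact: countable0|exact: subgroup0 (span_subgroup _)].
  move=> g h [W cW Wg] [W' cW' Wh]; exists (W `|` W').
    have -> : W `|` W' = \bigcup_(b in [set: bool]) (if b then W else W').
      apply/seteqP; split=> [x [?|?]|x [[] _ /= ?]].
      - by exists true.
      - by exists false.
      - by left.
      - by right.
    by apply: bigcup_countable => // -[] _.
  apply: (subgroupB (span_subgroup _)).
    by apply: span_sub Wg; apply: mono; left.
  by apply: span_sub Wh; apply: mono; right.
move=> v [[x ->]|[eta [n [_ ->]]]].
  by exists set0; [exact: countable0|apply: sub_span; left; exists x].
exists [set eta]; first exact: countable1.
by apply: sub_span; right; exists eta, n.
Qed.

Lemma branch_group_aleph_free : aleph_free (branch_group S a) j.+1.
Proof.
have [kappa alephK] := aleph_exists j.+1; exists kappa => // H sH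
  /(card_lt_aleph_thin alephK) thinH.
have /card_gt0P[i0 _] : (0 < #|Idx S|)%N by rewrite card_Idx.
have nodes (x : branch_group S a) : exists W : set (Node S),
    countable W /\ span (branch_gens a W) (span_val x).
  by have [W cW Wx] := span_countable_nodes (span_valP x); exists W.
have [W WP] := choice nodes.
pose A := \bigcup_(x in H) \bigcup_(i in [set: Idx S]) (@coord S i @` W x).
have thinA : thin j A.
  apply: thin_bigcup => // x _; apply: bigcup_countable => // i _.
  by apply: sub_countable (card_image_le _ _) _; case: (WP x).
have [|lt [l [N [arr _]]]] := arrange i0 (u := fun=> [set: Idx S]%SET) thinA.
  by move=> eta _; rewrite cardsT card_Idx.
apply: (arranged_free a_gt0 arr sH) => x Hx.
apply: span_sub (WP x).2 => v [[y ->]|[eta [n [Weta ->]]]]; first by left; exists y.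
right; exists eta, n; split=> // i.
by exists x => //; exists i => //; exists eta.
Qed.

End BranchGroupAlephFree.

(** * Splitting forces solutions *)

Section Splitting.
Variables (S : branching) (a : nat -> nat) (C : zmodType).
Hypothesis a_gt0 : forall n, (0 < a n)%N.
Variables (d : Node S -> nat -> C) (i0 : Idx S).

Local Notation V := (Key S -> int).

Definition twist eta n : nat -> C := fun M => \sum_(n <= i < M) d eta i *+ aprod a n i.

Definition twisted_gens : set (V * (nat -> C)) :=
  [set w | (exists x, w = (delta x, 0)) \/ exists eta n, w = (tail a eta n, twist eta n)].

Lemma twist_step eta n M : (n < M)%N ->
  twist eta n M - twist eta n.+1 M *+ a n = d eta n.
Proof.
move=> nM; rewrite /twist big_ltn // aprodnn mulr1n -sumrMnl.
have -> : \sum_(n.+1 <= i < M) d eta i *+ aprod a n.+1 i *+ a n =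
    \sum_(n.+1 <= i < M) d eta i *+ aprod a n i.
  by apply: eq_big_nat => i /andP[ni _]; rewrite -mulrnA mulnC -aprodSl.
by rewrite addrK.
Qed.

Let NodeC : choiceType := {classic Node S}.

Let form (n : nat) (q : {freeg NodeC / int}) (w : V * (nat -> C)) : Prop :=
  (forall eta, exists m0, forall m i, (m0 <= m)%N ->
     w.1 (key i m eta) = (aprod a n m)%:Z * coeff (eta : NodeC) q) /\
  forall M, (n <= M)%N ->
    w.2 M.+1 - w.2 M = lift (fun eta : NodeC => d eta M *+ aprod a n M) q.

Let form_raise n m q w : (n <= m)%N -> form n q w -> form m (q *~ (aprod a n m)%:Z) w.
Proof.
move=> nm [w1 w2]; split=> [eta|M mM].
  have [m0 m0P] := w1 eta; exists (maxn m m0) => p i; rewrite geq_max => /andP[mp m0p].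
  by rewrite m0P // raddfMz /= mulrzz (aprod_cat a nm mp) PoszM [RHS]mulrA [RHS]mulrC mulrA.
rewrite w2 ?(leq_trans nm) // raddfMz /= !freeg_additive_sum /= mulrz_suml.
apply: eq_bigr => eta _; rewrite /= !lift1 (aprod_cat a nm mM).
by rewrite !pmulrn -!mulrzA PoszM -mulrA [in LHS]mulrC mulrA.
Qed.

Let twisted_form w : span twisted_gens w -> exists n q, form n q w.
Proof.
move=> sw; apply: (sw [set w | exists n q, form n q w]).
  split.
    exists 0%N, 0; split=> [eta|M _]; last by rewrite (raddf0 (lift _)); exact: (subrr 0).
    by exists 0%N => m i _; rewrite coeff0 mulr0.
  move=> u v [n [q uq]] [m [r vr]]; exists (n + m)%N.
  have [u1 u2] := form_raise (leq_addr m n) uq.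
  have [v1 v2] := form_raise (leq_addl n m) vr.
  exists (q *~ (aprod a n (n + m))%:Z - r *~ (aprod a m (n + m))%:Z); split=> [eta|M nM].
    have [mu muP] := u1 eta; have [mv mvP] := v1 eta; exists (maxn mu mv) => p i.
    rewrite geq_max => /andP[mup mvp].
    by rewrite -[(u - v).1 _]/(u.1 _ - v.1 _) muP // mvP // coeffB mulrBr.
  rewrite -[(u - v).2 _]/(u.2 _ - v.2 _) -[(u - v).2 M]/(u.2 _ - v.2 _).
  by rewrite subrBB u2 // v2 // liftB.
move=> v [[x ->]|[eta [n ->]]].
  exists 0%N, 0; split=> [eta|M _]; last by rewrite (raddf0 (lift _)); exact: (subrr 0).
  exists (lev x).+1 => m i xm; rewrite coeff0 mulr0 /= delta_neq // => xE.
  by rewrite -xE key_lev ltnn in xm.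
exists n, << (eta : NodeC) >>; split=> [nu|M nM]; last first.
  by rewrite lift1 /= /twist big_nat_recr //= addrAC subrr add0r.
have [<-|neq] := pselect (eta = nu).
  by exists n => m i nm; rewrite /= tail_key nm coeffU eqxx !mulr1.
have [N NP] := key_sep neq; exists N => m i Nm /=.
rewrite tail_off ?coeffU; last first.
  move=> k; rewrite key_lev => kE; have [ik _] := key_coord kE.
  by apply: (NP m i Nm); rewrite kE ik.
by rewrite [_ == _]negbTE ?mulr0 //; exact/eqP.
Qed.

Let twisted_kernel w : span twisted_gens w -> w.1 = 0 ->
  exists c n, forall M, (n <= M)%N -> w.2 M = c.
Proof.
move=> /twisted_form[n [q [w1 w2]]] w0.
have q0 : q = 0.
  apply/eqP/freeg_eqP => eta; rewrite coeff0; have [m0 m0P] := w1 eta.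
  have := m0P m0 i0 (leqnn _); rewrite w0 => /esym/eqP.
  by rewrite mulf_eq0 eqz_nat eqn0Ngt aprod_gt0 // => /eqP.
exists (w.2 n), n => M; elim: M => [|M IH]; first by rewrite leqn0 => /eqP ->.
rewrite leq_eqVlt => /predU1P[->//|nM].
by apply/eqP; rewrite -(IH nM) -subr_eq0 w2 // q0 raddf0.
Qed.

Lemma ext0_solves : (forall e : Ext (branch_group S a) C, e = 0) ->
  exists g : Key S -> C, forall eta, exists x, solves a d g eta x.
Proof.
move=> ext0; pose E : zmodType := span_type twisted_gens.
have proj (w : E) : span (branch_gens a setT) (span_val w).1.
  suff : [set w | span (branch_gens a setT) w.1] (span_val w) by [].
  apply: (span_valP w).
    split; first exact: subgroup0 (span_subgroup _).
    by move=> u v; exact: (subgroupB (span_subgroup _)).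
  move=> v [[x ->]|[eta [n ->]]]; apply: sub_span; first by left; exists x.
  by right; exists eta, n.
pose p (w : E) : branch_group S a := to_span (proj w).
have pB : zmod_morphism p by move=> u v; exact: val_inj.
pose pa := GRing.isZmodMorphism.Build E (branch_group S a) p pB.
pose p' : {additive E -> branch_group S a} := HB.pack p pa.
have psurj y : exists w, p' w = y.
  have [s sP] : exists s, span twisted_gens (span_val y, s).
    suff : [set f | exists s, span twisted_gens (f, s)] (span_val y) by [].
    apply: (span_valP y).
      split; first by exists 0; exact: subgroup0 (span_subgroup _).
      move=> f g [s sf] [t tg]; exists (s - t).
      exact: (subgroupB (span_subgroup _) sf tg).
    move=> v [[x ->]|[eta [n [_ ->]]]].
      by exists 0; apply: sub_span; left; exists x.
    by exists (twist eta n); apply: sub_span; right; exists eta, n.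
  by exists (to_span sP); exact: val_inj.
have evc (w : E) : exists c, p' w = 0 -> exists n, forall M, (n <= M)%N -> (span_val w).2 M = c.
  have [pw|pw] := pselect (p' w = 0); last by exists 0.
  have w0 : (span_val w).1 = 0 by have := congr1 (@span_val _ _) pw.
  by have [c cP] := twisted_kernel (span_valP w) w0; exists c.
have [r rP] := choice evc.
have r_uniq w c n : p' w = 0 -> (forall M, (n <= M)%N -> (span_val w).2 M = c) -> r w = c.
  move=> pw wc; have [m mP] := rP w pw.
  by rewrite -(mP (n + m)%N) ?leq_addl // wc // leq_addr.
have rB u v : p' u = 0 -> p' v = 0 -> r (u - v) = r u - r v.
  move=> pu pv; have [n nP] := rP u pu; have [m mP] := rP v pv.
  apply: (@r_uniq _ _ (n + m)%N); first by rewrite raddfB pu pv subrr.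
  move=> M nmM; rewrite -[(span_val (u - v)).2 M]/((span_val u).2 M - (span_val v).2 M).
  by rewrite nP ?mP // (leq_trans _ nmM) // ?leq_addl ?leq_addr.
have [h hP] := ext0_extend_ker ext0 psurj rB.
have gdelta x : span twisted_gens (delta x, 0) by apply: sub_span; left; exists x.
have gtail eta n : span twisted_gens (tail a eta n, twist eta n).
  by apply: sub_span; right; exists eta, n.
pose D x : E := to_span (gdelta x); pose T eta n : E := to_span (gtail eta n).
exists (fun x => h (D x)) => eta; exists (fun n => h (T eta n)) => n.
pose w := T eta n - T eta n.+1 *+ a n - \sum_i D (key i n eta).
have -> : h (T eta n) - h (T eta n.+1) *+ a n - \sum_i h (D (key i n eta)) = h w.
  by rewrite /w 2!(raddfB h) (raddfMn h) (raddf_sum h).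
pose f1 (u : E) := (span_val u).1; pose f2 (u : E) := (span_val u).2.
have f1B : zmod_morphism f1 by [].
have f2B : zmod_morphism f2 by [].
pose a1 := GRing.isZmodMorphism.Build E V f1 f1B.
pose a2 := GRing.isZmodMorphism.Build E (nat -> C) f2 f2B.
pose g1 : {additive E -> V} := HB.pack f1 a1.
pose g2 : {additive E -> (nat -> C)} := HB.pack f2 a2.
have w1 : g1 w = 0 
  by rewrite /w 2!(raddfB g1) (raddfMn g1) (raddf_sum g1) /= -(tail_step a) subrr.
have w2 : g2 w = twist eta n - twist eta n.+1 *+ a n.
  by rewrite /w 2!(raddfB g2) (raddfMn g2) (raddf_sum g2) big1 ?subr0.
have pw : p' w = 0 by exact: val_inj.
rewrite hP //; apply: (r_uniq _ _ n.+1) => // M nM.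
rewrite -[LHS]/(g2 w M) w2 -(twist_step eta nM) -fctMn.
exact: (evalfB M).
Qed.

End Splitting.

Lemma ext0_solvable (k : nat) (C : zmodType) (a : nat -> nat) :
  (forall F : zmodType, aleph_free F k.+1 -> forall e : Ext F C, e = 0) ->
  (forall n, (0 < a n)%N) -> solvable C a.
Proof.
move=> ext0 a_gt0 c; apply: contrapT => nsol.
have [|S [cardS [d dP]]] := @diagonal_system C a c k.+1.
  by move=> x xc; apply: nsol; exists x.
have /card_gt0P[i0 _] : (0 < #|Idx S|)%N by rewrite cardS.
have [g gP] := ext0_solves a_gt0 d i0 (ext0 _ (branch_group_aleph_free a_gt0 cardS)).
by have [eta etaP] := dP g; have [x] := gP eta; exact: etaP.
Qed.

Lemma aleph_free_torsion_free (F : zmodType) (k : nat) :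
  aleph_free F k.+1 -> torsion_free F.
Proof.
move=> [kappa alephK freeK] x n n_gt0 xn0.
pose H : set F := range (fun z : int => x *~ z).
have sH : is_subgroup H.
  split; first by exists 0; rewrite ?mulr0z.
  by move=> _ _ [z _ <-] [z' _ <-]; exists (z - z'); rewrite ?mulrzBr.
have cH : countable H by apply: sub_countable (card_image_le _ _) _; exact: countableP.
have [I [f [finj fH]]] := freeK H sH (countable_lt_aleph alephK cH).
have [D _ Dx] : range f x by rewrite fH; exists 1; rewrite ?mulr1z.
have Dn : D *+ n = 0 by apply: finj; rewrite raddfMn raddf0 Dx.
suff D0 : D = 0 by rewrite -Dx D0 (raddf0 f).
apply/eqP/freeg_eqP => i; rewrite coeff0; apply/eqP.
have /eqP := congr1 (coeff i) Dn; rewrite coeff0 raddfMn -mulr_natr mulf_eq0.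
by rewrite natz eqz_nat [n == _]eqn0Ngt n_gt0 orbF.
Qed.

Theorem theorem2 (k : nat) (hk : (1 <= k)%N) (C : zmodType) :
  cotorsion C <->
  (forall F : zmodType, aleph_free F k -> forall e : Ext F C, e = 0).
Proof.
case: k hk => [//|k] _; split=> [cotC F /aleph_free_torsion_free|ext0 F tfF].
  exact: cotC.
by apply: torsion_free_ext0 tfF => a; exact: ext0_solvable ext0.
Qed.
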